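(* In $\mathsf{Partial}(\mathsf{BorelStoch})$, every standard Borel space $X$ admits an empirical sampling morphism $\mathsf{es}_X:X^{\mathbb{N}}\to X$.
   Context: $\mathbb{N}=\{1,2,3,\ldots\}$. $\mathsf{Partial}(\mathsf{BorelStoch})$ has standard Borel spaces as objects. A morphism $f:X\to Y$ is a partial Markov kernel: a measurable set $D_f\subseteq X$ (its domain) together with a Markov kernel $f(\cdot|x)$, $x\in D_f$, from $D_f$ to $Y$. The composite of $f:X\to Y$ and $g:Y\to Z$ has domain $D_{gf}=\{x\in D_f\mid f(D_g|x)=1\}$ and on it $(gf)(S|x)=\int_{D_g}g(S|y)\,f(dy|x)$. The tensor product of objects is the cartesian product with product $\sigma$-algebra; $f\otimes g$ for $f:A\to X$, $g:B\to Y$ has domain $D_f\times D_g$ and is given there by product measures. Two morphisms are equal iff they have the same domain and the same kernel on it. The Kolmogorov power $X^{\mathbb{N}}$ is the countable product with product $\sigma$-algebra. For a morphism $f:A\to X$, $f^{(\mathbb{N})}:A\to X^{\mathbb{N}}$ has domain $D_f$ and sends $a$ to the infinite product measure $f(\cdot|a)^{\otimes\mathbb{N}}$. For a finite permutation $\sigma$ of $\mathbb{N}$ (a bijection fixing all but finitely many elements), $X^\sigma:X^{\mathbb{N}}\to X^{\mathbb{N}}$ is the (everywhere defined) deterministic kernel given by $(x_i)\mapsto(x_{\sigma(i)})$. A morphism $f:A\to X^{\mathbb{N}}\otimes Y$ is exchangeable in the first factor if $(X^\sigma\otimes \mathrm{id}_Y)\,f=f$ for every finite permutation $\sigma$. An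 empirical sampling morphism for $X$ is a morphism $\mathsf{es}:X^{\mathbb{N}}\to X$ such that: (i) (permutation invariance) $\mathsf{es}\,X^\sigma=\mathsf{es}$ for every finite permutation $\sigma$ of $\mathbb{N}$; (ii) (empirical adequacy) for all objects $A,Y$ and every morphism $f:A\to X^{\mathbb{N}}\otimes Y$ exchangeable in the first factor, $(\mathsf{es}^{(\mathbb{N})}\otimes \mathrm{id}_Y)\,f=f$. *)

(* Defs.v *)
From HB Require Import structures.
From mathcomp Require Import all_boot all_order all_algebra.
From mathcomp Require Import all_classical all_reals all_analysis.
From mathcomp Require Import measurable_realfun.

Set Implicit Arguments.
Unset Strict Implicit.
Unset Printing Implicit Defensive.

Import Order.TTheory GRing.Theory Num.Theory.

Local Open Scope classical_set_scope.
Local Open Scope ring_scope.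
Local Open Scope ereal_scope.

(* In the library a measurableType is pointed, hence nonempty.  So that the
   empty space is an object too, a measurable space is represented by a
   measurable subset [carrier] of a measurableType; the points outside
   [carrier] are irrelevant, and measurable subsets of the space are the
   measurable sets contained in [carrier]. *)
Record mspace := MSpace {
  ms_display : measure_display ;
  ms_type :> measurableType ms_display ;
  carrier : set ms_type ;
  measurable_carrier : measurable carrier }.

Arguments carrier X : clear implicits, rename.
Arguments measurable_carrier X : clear implicits, rename.

(* The carrier is Borel isomorphic, through [j], to a complete separable
   metric space P (possibly empty: a metricType need not be pointed). *)
Definition standard_borel (R : realType) (X : mspace) : Prop :=
  exists (P : metricType R) (j : P -> X),
    [/\ forall F : set_system P,
          ProperFilter F -> cauchy F -> exists p : P, F --> p,
        exists2 S : set P, countable S & dense S,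
        injective j,
        range j = carrier X &
        forall B : set P, <<s [set U : set P | open U] >> B <->
                          measurable (j @` B)].

Section product_spaces.

Lemma measurable_carrier_prod (X Y : mspace) :
  measurable (carrier X `*` carrier Y).
Proof. by apply: measurableX; exact: measurable_carrier. Qed.

Definition mprod (X Y : mspace) : mspace := MSpace (@measurable_carrier_prod X Y).

Definition coordinate_sets d (T : measurableType d) : set (set (nat -> T)) :=
  \bigcup_n preimage_set_system setT (fun u : nat -> T => u n) measurable.
Arguments coordinate_sets {d} T.

Definition sequence_space d (T : measurableType d) :=
  g_sigma_algebraType (coordinate_sets T).

HB.instance Definition _ d (T : measurableType d) :=
  Measurable.on (sequence_space T).

Lemma measurable_coordinate d (T : measurableType d) (n : nat) :
  measurable_fun setT (fun u : sequence_space T => u n).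
Proof.
by move=> _ A mA; apply: sub_sigma_algebra; exists n => //; exists A.
Qed.

Lemma measurable_fun_sequence d d' (S : measurableType d)
    (T : measurableType d') (h : S -> sequence_space T) :
  (forall n, measurable_fun setT (fun s => h s n)) -> measurable_fun setT h.
Proof.
move=> mh; apply: (@measurability _ _ S (sequence_space T) setT h
  (coordinate_sets T)) => // _ [_ [n _ [A mA <-]] <-].
rewrite setTI preimage_setI preimage_setT setTI -[X in measurable X]setTI.
exact: mh.
Qed.

Definition carrier_power (X : mspace) : set (sequence_space X) :=
  [set u | forall n, carrier X (u n)].

Arguments carrier_power X : clear implicits.

Lemma measurable_carrier_power (X : mspace) : measurable (carrier_power X).
Proof.
rewrite (_ : carrier_power X =
    \bigcap_n [set u : sequence_space X | carrier X (u n)]).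
  apply: bigcap_measurable => // n _.
  rewrite -[X in measurable X]setTI.
  exact: measurable_coordinate (measurable_carrier X).
by apply/seteqP; split => u /= uX n => [_|]; exact: uX.
Qed.

Definition mpower (X : mspace) : mspace := MSpace (@measurable_carrier_power X).

End product_spaces.

(* Only the restriction of [pk] to [dom] is meaningful: see [pkeq].  Values are
   subprobabilities so that [pk] has some value off the domain even when the
   target is empty; on the domain they are probability measures on the
   carrier of the target. *)
Record pkernel (R : realType) (X Y : mspace) := PKernel {
  pk :> X -> subprobability Y R ;
  dom : set X ;
  dom_carrier : dom `<=` carrier X ;
  measurable_dom : measurable dom ;
  measurable_pk : forall U, measurable U ->
    measurable_fun dom (fun x => pk x U) ;
  pk_carrier : forall x, dom x -> pk x (carrier Y) = 1 }.

Arguments dom {R X Y} p.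
Arguments dom_carrier {R X Y} p.
Arguments measurable_dom {R X Y} p.
Arguments measurable_pk {R X Y} p [U].
Arguments pk_carrier {R X Y} p [x].

Definition pkeq (R : realType) (X Y : mspace) (f g : pkernel R X Y) : Prop :=
  dom f = dom g /\
  forall x, dom f x -> forall U, measurable U -> f x U = g x U.

Section deterministic.
Variables (R : realType) (X Y : mspace) (h : X -> Y).
Hypothesis mh : measurable_fun setT h.
Hypothesis hXY : forall x, carrier X x -> carrier Y (h x).

Definition pkdet_ker (x : X) : subprobability Y R := @dirac _ Y (h x) R.

Lemma measurable_pkdet (U : set Y) : measurable U ->
  measurable_fun (carrier X) (fun x => pkdet_ker x U).
Proof.
move=> mU; apply: measurable_funTS; apply/measurable_EFinP.
exact: (measurableT_comp (measurable_indic mU) mh).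
Qed.

Lemma pkdet_carrier x : carrier X x -> pkdet_ker x (carrier Y) = 1.
Proof.
by move=> Xx; rewrite /pkdet_ker /= diracE mem_set//; exact: hXY.
Qed.

Definition pkdet : pkernel R X Y :=
  PKernel (@subset_refl _ _) (measurable_carrier X) measurable_pkdet pkdet_carrier.

End deterministic.

Definition pkid (R : realType) (X : mspace) : pkernel R X X :=
  pkdet R (@measurable_id _ X setT) (fun x Xx => Xx).

Section zero_extension.
Variables (R : realType) (X Y : mspace) (f : pkernel R X Y).

Definition pkext_fun (x : X) : {measure set Y -> \bar R} :=
  if x \in dom f then f x else mzero.

Lemma measurable_pkext U : measurable U ->
  measurable_fun setT (fun x => pkext_fun x U).
Proof.
move=> mU; rewrite (_ : (fun x => pkext_fun x U) = (fun x => f x U) \_ (dom f)).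
  apply/(measurable_restrictT _ (measurable_dom f)).
  exact: measurable_pk.
by apply/funext => x; rewrite /pkext_fun patchE; case: ifPn.
Qed.

HB.instance Definition _ := isKernel.Build _ _ _ _ R pkext_fun measurable_pkext.

Lemma pkext_uub : measure_fam_uub pkext_fun.
Proof.
exists 2%R => x; rewrite /pkext_fun; case: ifPn => _.
  by rewrite (le_lt_trans (sprobability_setT (s := f x)))// lte_fin ltr1n.
by rewrite /mzero/= lte_fin.
Qed.

HB.instance Definition _ := Kernel_isFinite.Build _ _ _ _ R pkext_fun pkext_uub.

Definition pkext : R.-fker X ~> Y := pkext_fun.

Lemma pkextE x : dom f x -> pkext x = f x :> {measure set Y -> \bar R}.
Proof. by move=> fx; rewrite /pkext /= /pkext_fun mem_set. Qed.

End zero_extension.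

Section composition.
Variables (R : realType) (X Y Z : mspace).
Variables (g : pkernel R Y Z) (f : pkernel R X Y).

Section measure.
Variable x : X.

Definition pkcomp_fun (U : set Z) : \bar R := \int[f x]_(y in dom g) g y U.

Let pkcomp0 : pkcomp_fun set0 = 0.
Proof. by apply: integral0_eq => y _; rewrite measure0. Qed.

Let pkcomp_ge0 U : 0 <= pkcomp_fun U.
Proof. exact: integral_ge0. Qed.

Let pkcomp_sigma_additive : semi_sigma_additive pkcomp_fun.
Proof.
move=> F mF tF mUF; rewrite [X in _ --> X](_ : _ =
    \sum_(n <oo) pkcomp_fun (F n)).
  by apply/cvg_closeP; split; [exact: is_cvg_nneseries|rewrite closeE].
rewrite -integral_nneseries//.
- apply: eq_integral => y _; apply/esym/cvg_lim => //.
  exact: measure_semi_sigma_additive.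
- exact: measurable_dom.
- by move=> n; exact: measurable_pk.
Qed.

HB.instance Definition _ := isMeasure.Build _ _ _ pkcomp_fun
  pkcomp0 pkcomp_ge0 pkcomp_sigma_additive.

Let pkcomp_setT : pkcomp_fun setT <= 1.
Proof.
apply: (@le_trans _ _ (\int[f x]_(y in dom g) (cst 1 y))).
  apply: ge0_le_integral => //.
  - exact: measurable_dom.
  - exact: measurable_pk.
  - by move=> y _; exact: sprobability_setT.
rewrite integral_cst; last exact: measurable_dom.
rewrite mul1e (le_trans _ (sprobability_setT (s := f x)))//.
by apply: le_measure; rewrite ?inE//; exact: measurable_dom.
Qed.

HB.instance Definition _ :=
  Measure_isSubProbability.Build _ _ _ pkcomp_fun pkcomp_setT.

Definition pkcomp_ker : subprobability Z R := pkcomp_fun.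

End measure.

Definition pkcomp_dom : set X := [set x | dom f x /\ f x (dom g) = 1].

Lemma pkcomp_dom_carrier : pkcomp_dom `<=` carrier X.
Proof. by move=> x [/dom_carrier]. Qed.

Lemma measurable_pkcomp_dom : measurable pkcomp_dom.
Proof.
have := measurable_pk f (measurable_dom g) (measurable_dom f)
  [set 1] (@emeasurable_set1 R 1).
by [].
Qed.

Lemma measurable_pkcomp U : measurable U ->
  measurable_fun pkcomp_dom (fun x => pkcomp_ker x U).
Proof.
move=> mU.
apply: (eq_measurable_fun (fun x => \int[pkext f x]_y pkext g y U)).
  move=> x; rewrite inE => -[fx _]; rewrite pkextE//.
  rewrite /pkcomp_ker /= /pkcomp_fun [RHS]integral_mkcond.
  apply: eq_integral => y _; rewrite patchE /pkext /= /pkext_fun.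
  by case: ifPn.
apply: measurable_funTS.
apply: measurable_fun_integral_kernel => //.
- exact: measurable_kernel.
- exact: measurable_kernel.
Qed.

Lemma pkcomp_carrier x : pkcomp_dom x -> pkcomp_ker x (carrier Z) = 1.
Proof.
move=> [fx fg]; rewrite /pkcomp_ker /= /pkcomp_fun.
rewrite (eq_integral (cst 1)); last first.
  by move=> y; rewrite inE => gy; exact: pk_carrier.
by rewrite integral_cst ?mul1e//; exact: measurable_dom.
Qed.

(* [g] after [f] *)
Definition pkcomp : pkernel R X Z :=
  PKernel pkcomp_dom_carrier measurable_pkcomp_dom measurable_pkcomp pkcomp_carrier.

End composition.

Section kernel_pullback.
Context d d1 d2 (S' : measurableType d) (S : measurableType d1)
  (T : measurableType d2) (R : realType).
Variables (k : R.-fker S ~> T) (h : S' -> S).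
Hypothesis mh : measurable_fun setT h.

Definition kpullback_fun (x : S') : {measure set T -> \bar R} := k (h x).

Lemma measurable_kpullback U : measurable U ->
  measurable_fun setT (fun x => kpullback_fun x U).
Proof. by move=> mU; exact: measurableT_comp (measurable_kernel k U mU) mh. Qed.

HB.instance Definition _ :=
  isKernel.Build _ _ _ _ R kpullback_fun measurable_kpullback.

Lemma kpullback_uub : measure_fam_uub kpullback_fun.
Proof. by have [r kr] := measure_uub k; exists r => x; exact: kr. Qed.

HB.instance Definition _ :=
  Kernel_isFinite.Build _ _ _ _ R kpullback_fun kpullback_uub.

Definition kpullback : R.-fker S' ~> T := kpullback_fun.

End kernel_pullback.

Section tensor.
Variables (R : realType) (A B X Y : mspace).
Variables (f : pkernel R A X) (g : pkernel R B Y).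

Definition pktensor_ker (ab : mprod A B) : subprobability (mprod X Y) R :=
  product_subprobability (f ab.1, g ab.2).

Definition pktensor_dom : set (mprod A B) := dom f `*` dom g.

Lemma pktensor_dom_carrier : pktensor_dom `<=` carrier (mprod A B).
Proof.
move=> -[a b] [/= fa gb].
by split; [exact: (dom_carrier f)|exact: (dom_carrier g)].
Qed.

Lemma measurable_pktensor_dom : measurable pktensor_dom.
Proof. by apply: measurableX; exact: measurable_dom. Qed.

Lemma measurable_pktensor U : measurable U ->
  measurable_fun pktensor_dom (fun ab => pktensor_ker ab U).
Proof.
move=> mU.
have m2 : measurable_fun setT (fun p : A * B * X => p.1.2).
  exact: (measurableT_comp measurable_snd measurable_fst).
pose k1 := kpullback (pkext f) (@measurable_fst _ _ A B).
pose k2 := kpullback (pkext g) m2.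
apply: (eq_measurable_fun (fun ab => kproduct k1 k2 ab U)).
  move=> [a b]; rewrite inE => -[/= fa gb].
  have k1E : k1 (a, b) = f a :> {measure set X -> \bar R} by exact: pkextE.
  have k2E x : k2 (a, b, x) = g b :> {measure set Y -> \bar R}.
    exact: pkextE.
  rewrite /pktensor_ker /= /product_measure1 /kproduct k1E.
  apply: eq_integral => x _; rewrite kernel.intker_indicE//.
  exact: (congr1 (fun m : {measure set Y -> \bar R} => m (xsection U x)) (k2E x)).
by apply: measurable_funTS; exact: measurable_kproduct.
Qed.

Lemma pktensor_carrier ab : pktensor_dom ab ->
  pktensor_ker ab (carrier (mprod X Y)) = 1.
Proof.
move=> [fa gb]; rewrite /pktensor_ker /=.
rewrite product_measure1E; [|exact: measurable_carrier..].
by rewrite -[RHS]mule1; congr (_ * _); exact: pk_carrier.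
Qed.

Definition pktensor : pkernel R (mprod A B) (mprod X Y) :=
  PKernel pktensor_dom_carrier measurable_pktensor_dom measurable_pktensor
    pktensor_carrier.

End tensor.

(* [fN] is the power of [f]: on the domain of [f], fN(.|a) is the infinite
   product of copies of f(.|a), that is, the measure giving the product value
   to every measurable box with finitely many constrained coordinates.  Such a
   measure is unique: see [is_power_unique]. *)
Definition is_power (R : realType) (A X : mspace) (f : pkernel R A X)
    (fN : pkernel R A (mpower X)) : Prop :=
  dom fN = dom f /\
  forall a, dom f a -> forall (n : nat) (S : nat -> set X),
    (forall i, measurable (S i)) ->
    fN a [set u : mpower X | forall i, (i < n)%N -> S i (u i)] =
      \prod_(i < n) f a (S i).

Section power_unique.

Definition boxes d (T : measurableType d) : set (set (nat -> T)) :=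
  [set B | exists (n : nat) (S : nat -> set T), (forall i, measurable (S i)) /\
    B = [set u | forall i, (i < n)%N -> S i (u i)]].
Arguments boxes {d} T.

Lemma boxesE d (T : measurableType d) :
  @measurable _ (sequence_space T) = <<s boxes T >>.
Proof.
apply/seteqP; split.
  apply: smallest_sub; first exact: (smallest_sigma_algebra setT (boxes T)).
  move=> _ [n _ [A mA <-]]; rewrite setTI; apply: sub_sigma_algebra.
  exists n.+1, (fun i => if i == n then A else setT); split.
    by move=> i; case: ifP.
  apply/seteqP; split => u /=; first by move=> Au i _; case: eqP => // ->.
  by move=> /(_ n (ltnSn n)); rewrite eqxx.
apply: smallest_sub; first exact: sigma_algebra_measurable.
move=> _ [n [S [mS ->]]].
rewrite (_ : [set u | _] = \bigcap_(i < n)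
    (setT `&` (fun u : sequence_space T => u i) @^-1` S i)); last first.
  apply/seteqP; split => u /=; first by move=> Su i /= /Su.
  by move=> Su i /Su [].
apply: bigcap_measurableType => i _.
exact: (@measurable_coordinate _ T i measurableT (S i) (mS i)).
Qed.

Lemma setI_closed_boxes d (T : measurableType d) : setI_closed (boxes T).
Proof.
move=> _ _ [n [S [mS ->]]] [m [S' [mS' ->]]].
exists (maxn n m), (fun i => (if (i < n)%N then S i else setT) `&`
                             (if (i < m)%N then S' i else setT)); split.
  by move=> i; apply: measurableI; case: ifP.
apply/seteqP; split => u /=.
  move=> [Su S'u] i _; split; case: ifPn => // im; [exact: Su|exact: S'u].
move=> H; split => i im; have := H i; rewrite leq_max im ?orbT => /(_ isT) [].
  by [].
by [].
Qed.

Lemma is_power_unique (R : realType) (A X : mspace) (f : pkernel R A X)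
    (fN fN' : pkernel R A (mpower X)) :
  is_power f fN -> is_power f fN' -> pkeq fN fN'.
Proof.
move=> [df Hf] [df' Hf']; split; first by rewrite df df'.
move=> a; rewrite df => fa U mU.
apply: (@measure_unique _ R (sequence_space X) (boxes X) (fun=> setT)
  _ _ _ _ (fN a) (fN' a)) => //.
- exact: boxesE.
- exact: setI_closed_boxes.
- by move=> _; exists 0%N, (fun=> setT); split => //; apply/seteqP; split.
- by rewrite bigcup_const//; exists 0%N.
- move=> _ [n [S [mS ->]]].
  exact: etrans (Hf a fa n S mS) (esym (Hf' a fa n S mS)).
- move=> _; apply: le_lt_trans (sprobability_setT (s := fN a)) _.
  by rewrite ltry.
Qed.

End power_unique.

Definition finite_permutation (s : nat -> nat) : Prop :=
  bijective s /\ finite_set [set n | s n != n].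

Section permutation_action.
Variables (R : realType) (X : mspace) (s : nat -> nat).

Definition permute_seq (u : mpower X) : mpower X := fun n => u (s n).

Lemma measurable_permute_seq : measurable_fun setT permute_seq.
Proof. by apply: measurable_fun_sequence => n; exact: measurable_coordinate. Qed.

Lemma permute_seq_carrier u :
  carrier (mpower X) u -> carrier (mpower X) (permute_seq u).
Proof. by move=> uX n; exact: uX. Qed.

Definition pkperm : pkernel R (mpower X) (mpower X) :=
  pkdet R measurable_permute_seq permute_seq_carrier.

End permutation_action.

Definition exchangeable (R : realType) (A X Y : mspace)
    (f : pkernel R A (mprod (mpower X) Y)) : Prop :=
  forall s, finite_permutation s ->
    pkeq (pkcomp (pktensor (pkperm R X s) (pkid R Y)) f) f.

(* The power of [es] is unique up to [pkeq], so the existential quantifier in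
   the second clause only names it. *)
Definition empirical_sampling (R : realType) (X : mspace)
    (es : pkernel R (mpower X) X) : Prop :=
  (forall s, finite_permutation s -> pkeq (pkcomp es (pkperm R X s)) es) /\
  exists2 esN : pkernel R (mpower X) (mpower X), is_power es esN &
    forall A Y : mspace, standard_borel R A -> standard_borel R Y ->
      forall f : pkernel R A (mprod (mpower X) Y), exchangeable f ->
        pkeq (pkcomp (pktensor esN (pkid R Y)) f) f.

(* Main.v *)
Require Import Defs.
From HB Require Import structures.
From mathcomp Require Import all_boot all_order all_algebra.
From mathcomp Require Import all_classical all_reals all_analysis.
From mathcomp Require Import measurable_realfun.
From mathcomp Require Import ring lra zify.

(** The statement is de Finetti's theorem in the following form: if nu is an
    exchangeable law on sequences in X, then almost every sequence u has
    limiting frequencies, these are the values of a probability measure es(u),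
    and the mean of the infinite power of es(u) under nu is nu itself.

    Frequencies only determine a measure if no mass escapes in the limit, so
    they are taken after transporting X into the Cantor space of binary
    sequences, where any consistent assignment of weights to finite prefixes is
    a probability measure ([tree_measure]).  The transport does not have to be
    a Borel isomorphism onto a Borel set: it is enough that X is a measurable
    retract, phi : X -> cantor and psi : cantor -> X with psi (phi x) = x
    ([standard_borel_retract]).  The prefix frequencies of phi along u form the
    weights of a measure Lam(u) on the Cantor space ([empirical_measure]), and
    es(u) is the image of Lam(u) under psi.  The domain of es consists of the
    sequences whose upper frequencies are additive along the tree of prefixes;
    upper frequencies do not see finite permutations, whence permutation
    invariance.

    Infinite powers exist over the Cantor space ([power_exists]) because one can
    build a law on binary sequences whose even digits have a prescribed law and
    whose odd digits are an independent copy of the whole sequence; reading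
    off even digits repeatedly then gives an independent identically
    distributed sequence ([infinite_product_measure]).

    Empirical adequacy may be tested on sets S x T, and for fixed T and a the
    finite measure S |-> f(S x T | a) is exchangeable, so that the second factor
    disappears from the problem ([slice], [pkcomp_tensor_rect]).  For an
    exchangeable finite measure, the frequencies at times 4^k have increments
    of square mean at most 4^-k times the total mass, hence converge almost
    everywhere ([ae_cvg_frequency]).  To compute the mean of a product of
    limiting frequencies, replace the indicators of the coordinates one by one
    by the limiting frequencies: by exchangeability one coordinate may be moved
    far away, then averaged over all far positions
    ([expectation_upper_frequency]). *)

Set Implicit Arguments.
Unset Strict Implicit.
Unset Printing Implicit Defensive.

Import Order.TTheory GRing.Theory Num.Theory.
Import numFieldNormedType.Exports.

Local Open Scope classical_set_scope.
Local Open Scope ring_scope.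

(** * Cylinders of the Cantor space *)

Notation cantor := (sequence_space bool).

Section cylinders.

Definition cylinder (s : seq bool) : set cantor :=
  [set z | mkseq z (size s) = s].

Lemma cylinder_nil : cylinder [::] = setT.
Proof. by apply/seteqP; split. Qed.

Lemma cylinder_rcons s b :
  cylinder (rcons s b) = cylinder s `&` [set z | z (size s) = b].
Proof.
apply/seteqP; split => z; rewrite /cylinder /= size_rcons mkseqS.
  by move/rcons_inj => [].
by move=> [-> ->].
Qed.

Lemma cylinderU s :
  cylinder s = cylinder (rcons s false) `|` cylinder (rcons s true).
Proof.
rewrite !cylinder_rcons -setIUr; apply/esym/setIidPl => z _ /=.
by case: (z (size s)); [right|left].
Qed.

Lemma cylinderI0 s :
  cylinder (rcons s false) `&` cylinder (rcons s true) = set0.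
Proof.
by apply/seteqP; split => // z; rewrite !cylinder_rcons => -[[_ /= ->] []].
Qed.

Lemma measurable_cylinder s : measurable (cylinder s).
Proof.
elim/last_ind: s => [|s b IH]; first by rewrite cylinder_nil.
rewrite cylinder_rcons; apply: measurableI => //.
rewrite -[X in measurable X]setTI.
exact: (@measurable_coordinate _ bool (size s) measurableT [set b]).
Qed.
Hint Resolve measurable_cylinder : core.

Lemma measure_cylinder (R : realType) (m : {measure set cantor -> \bar R}) s :
  m (cylinder s) = (m (cylinder (rcons s false)) + m (cylinder (rcons s true)))%E.
Proof. by rewrite cylinderU measureU//; exact: cylinderI0. Qed.

(** Two cylinders are nested or disjoint, so the empty set is all that is missing
    for the family to be closed under intersection. *)
Definition cylinders : set (set cantor) :=
  [set A | A = set0 \/ exists s, A = cylinder s].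

Lemma setI_closed_cylinders : setI_closed cylinders.
Proof.
suff H s t : (size s <= size t)%N -> cylinders (cylinder s `&` cylinder t).
  move=> _ _ [->|[s ->]] [->|[t ->]]; rewrite ?(set0I, setI0); try by left.
  have [st|/ltnW st] := leqP (size s) (size t); first exact: H.
  by rewrite setIC; exact: H.
move=> st; (* The longer prefix decides membership in the shorter cylinder. *)
have tE z : cylinder t z -> mkseq z (size s) = take (size s) t.
  move=> <-; rewrite -(subnKC st) /mkseq iotaD map_cat take_cat.
  by rewrite size_map size_iota ltnn subnn take0 cats0.
have [e|ne] := eqVneq (take (size s) t) s.
  by right; exists t; apply/setIidPr => z /tE; rewrite e.
left; apply/seteqP; split => // z [/= zs /tE].
by rewrite zs => es; rewrite -es eqxx in ne.
Qed.

Lemma cylindersE : measurable = <<s cylinders>>.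
Proof.
apply/seteqP; split; last first.
  apply: smallest_sub; first exact: sigma_algebra_measurable.
  by move=> _ [->//|[s ->]].
apply: smallest_sub; first exact: smallest_sigma_algebra.
move=> _ [n _ [A mA <-]].
rewrite (_ : _ `&` _ = \bigcup_(s : seq bool)
    (if (size s == n.+1) && `[< A (nth false s n) >] then cylinder s else set0)).
  apply: (@countable_bigcupT_measurable _ (g_sigma_algebraType cylinders)) => //.
  by move=> s; apply: sub_sigma_algebra; case: ifPn => _; [right; exists s|left].
apply/seteqP; split => z /=.
  move=> [_ Az]; exists (mkseq z n.+1) => //.
  have -> : size (mkseq z n.+1) = n.+1 by exact: size_mkseq.
  have -> : nth false (mkseq z n.+1) n = z n by exact: nth_mkseq.
  rewrite eqxx asboolT//=.
  by rewrite /cylinder /= size_map size_iota.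
move=> [s _]; case: ifPn => // /andP[/eqP ss /asboolP As] zs; split => //.
by rewrite -[s in nth _ s]zs ss (@nth_mkseq bool) in As.
Qed.

Lemma cylinder_measure_unique (R : realType)
    (m1 m2 : {measure set cantor -> \bar R}) :
  (m1 setT < +oo)%E -> (forall s, m1 (cylinder s) = m2 (cylinder s)) ->
  forall A, measurable A -> m1 A = m2 A.
Proof.
move=> m1T m12; apply: (measure_unique cylinders (fun=> setT)) => //.
- exact: cylindersE.
- exact: setI_closed_cylinders.
- by move=> _; right; exists [::]; rewrite cylinder_nil.
- by rewrite bigcup_const//; exists 0%N.
- by move=> _ [->|[s ->//]]; rewrite !measure0.
Qed.

End cylinders.
#[global] Hint Resolve measurable_cylinder : core.

(** * Measures on the Cantor space with prescribed cylinder weights *)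

(** The pushforward is a measure only in the presence of a proof that [f] is
    measurable; this packs the proof with it. *)
Definition image_measure d1 d2 (T1 : measurableType d1) (T2 : measurableType d2)
    (R : realType) (m : {measure set T1 -> \bar R}) (f : T1 -> T2)
    (mf : measurable_fun setT f) : {measure set T2 -> \bar R} :=
  ltac:(refine (pushforward m f : {measure set T2 -> \bar R}); exact: mf).

Section probability_of_measure.
Context d (T : measurableType d) (R : realType) (m : {measure set T -> \bar R}).
Hypothesis m1 : m setT = 1%E.

Let p : set T -> \bar R := m.
HB.instance Definition _ := Measure.on p.
HB.instance Definition _ := Measure_isProbability.Build _ _ _ p m1.

Lemma probability_of_measure : exists q : probability T R, forall A, q A = m A.
Proof. by exists p. Qed.

End probability_of_measure.

Section tree_measure.
Context (R : realType) (w : seq bool -> R).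
Hypothesis w_ge0 : forall s, 0 <= w s.
Hypothesis w_nil : w [::] = 1.
Hypothesis w_split : forall s, w s = w (rcons s false) + w (rcons s true).

(** The left end of the interval of length [w s] that is attached to the prefix
    [s]: the total weight of the prefixes that branch off [s] to the left. *)
Let offset (s : seq bool) : R :=
  \sum_(i < size s | nth false s i) w (rcons (take i s) false).

Let offset_rcons s b :
  offset (rcons s b) = offset s + (if b then w (rcons s false) else 0).
Proof.
have tk i : (i <= size s)%N -> take i (rcons s b) = take i s.
  by move=> si; rewrite -cats1 takel_cat.
rewrite /offset big_mkcond size_rcons big_ord_recr/= nth_rcons ltnn eqxx.
rewrite tk// take_size; congr (_ + _); rewrite [RHS]big_mkcond.
by apply: eq_bigr => i _; rewrite nth_rcons ltn_ord tk// ltnW.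
Qed.

Let branch (s : seq bool) (x : R) : bool := offset s + w (rcons s false) <= x.

(** The prefix of length [n] of the digits of [x], found by descending into the
    subinterval that contains [x]. *)
Let Fixpoint address (x : R) (n : nat) : seq bool :=
  if n is m.+1 then rcons (address x m) (branch (address x m) x) else [::].

Let digits (x : R) : cantor := fun n => branch (address x n) x.

Let mkseq_digits x n : mkseq (digits x) n = address x n.
Proof. by elim: n => // n IH; rewrite mkseqS IH. Qed.

Let digits_cylinder_rcons s b :
  digits @^-1` (cylinder (rcons s b)) =
  digits @^-1` (cylinder s) `&` [set x | branch s x = b].
Proof.
apply/seteqP; split => x /=; rewrite cylinder_rcons /cylinder/= mkseq_digits.
  by move=> [xs <-]; rewrite /digits xs.
by move=> [xs xb]; rewrite /digits xs.
Qed.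

Let measurable_digits : measurable_fun setT digits.
Proof.
apply: (@measurability _ _ R cantor setT digits cylinders cylindersE).
move=> _ [_ [->|[s ->]] <-]; rewrite ?preimage_set0 setTI//.
elim/last_ind: s => [|s b IH]; first by rewrite cylinder_nil preimage_setT.
rewrite digits_cylinder_rcons; apply: measurableI => //.
have := @measurable_fun_ler _ R R setT (cst (offset s + w (rcons s false))) id.
move=> /(_ (@measurable_cst _ _ _ _ _ _) (@measurable_id _ _ _)).
by move=> /(_ measurableT [set b]); rewrite setTI; exact.
Qed.

(** Outside of [0, 1[ the digits are meaningless, hence the intersection. *)
Let digits_itv s : `[0, 1[ `&` digits @^-1` (cylinder s) =
  [set` `[offset s, offset s + w s[ ].
Proof.
elim/last_ind: s => [|s b IH].
  by rewrite cylinder_nil preimage_setT setIT w_nil /offset big_ord0 add0r.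
rewrite digits_cylinder_rcons setIA IH offset_rcons w_split.
have := w_ge0 (rcons s false); have := w_ge0 (rcons s true).
move=> wt wf; apply/seteqP; split => x; rewrite /= !in_itv/= /branch.
  move=> [/andP[h1 h2] <-].
  by case: (leP (_ + w (rcons s false)) x) => h /=; apply/andP; split; lra.
move=> /andP[h1 h2]; split; first by case: b h1 h2 => /= h1 h2; apply/andP; split; lra.
by case: b h1 h2 => /= h1 h2; [apply/idP|apply/negbTE; rewrite -ltNge]; lra.
Qed.

(** Cutting [0, 1[ from left to right in proportion to the weights attaches to
    every prefix an interval whose length is its weight, and the digits of a
    point are the address of the nested intervals that contain it; the image of
    Lebesgue measure is the required law. *)
Lemma tree_measure :
  exists m : probability cantor R, forall s, m (cylinder s) = (w s)%:E.
Proof.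
pose P : {measure set cantor -> \bar R} :=
  image_measure (mrestr (@lebesgue_measure R) (@measurable_itv R `[0, 1[))
    measurable_digits.
have P1 : P setT = 1%E.
  rewrite /P /= /pushforward/= /mrestr preimage_setT setTI.
  by rewrite lebesgue_measure_itv/= lte_fin ltr01 oppr0 adde0.
have [m mP] := probability_of_measure P1.
exists m => s; rewrite mP /P /= /pushforward /mrestr setIC digits_itv.
rewrite lebesgue_measure_itv/= lte_fin; case: ifPn => [_|].
  by rewrite -EFinB addrAC subrr add0r.
by rewrite ltrDl -leNgt => w0; congr EFin; apply/eqP; rewrite eq_le w0 w_ge0.
Qed.

End tree_measure.

(** * Infinite powers of a law on the Cantor space *)

Section infinite_product.
Context (R : realType) (lam : probability cantor R).

Let zevens (z : cantor) : cantor := fun n => z n.*2.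
Let zodds (z : cantor) : cantor := fun n => z n.*2.+1.

Let measurable_zevens : measurable_fun setT zevens.
Proof. by apply: measurable_fun_sequence => n; exact: measurable_coordinate. Qed.

Let measurable_zodds : measurable_fun setT zodds.
Proof. by apply: measurable_fun_sequence => n; exact: measurable_coordinate. Qed.

Let evens (s : seq bool) := mkseq (fun i => nth false s i.*2) (uphalf (size s)).
Let odds (s : seq bool) := mkseq (fun i => nth false s i.*2.+1) (size s)./2.

Let evens_rcons s b :
  evens (rcons s b) = if odd (size s) then evens s else rcons (evens s) b.
Proof.
have nthE i : (i < uphalf (size s))%N -> nth false (rcons s b) i.*2 = nth false s i.*2.
  by move=> ilt; rewrite nth_rcons ifT//; lia.
rewrite /evens size_rcons -[uphalf _.+1]/((size s)./2.+1).
case: ifPn => os.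
  have -> : (size s)./2.+1 = uphalf (size s) by rewrite uphalf_half os.
  by apply/eq_in_map => i; rewrite mem_iota add0n /= => /nthE.
have us : uphalf (size s) = (size s)./2 by rewrite uphalf_half (negbTE os).
rewrite mkseqS -us; congr rcons.
  by apply/eq_in_map => i; rewrite mem_iota add0n /= => /nthE.
by rewrite us even_halfK// nth_rcons ltnn eqxx.
Qed.

Let odds_rcons s b :
  odds (rcons s b) = if odd (size s) then rcons (odds s) b else odds s.
Proof.
have nthE i : (i < (size s)./2)%N ->
    nth false (rcons s b) i.*2.+1 = nth false s i.*2.+1.
  by move=> ilt; rewrite nth_rcons ifT//; lia.
rewrite /odds size_rcons -[(_.+1)./2]/(uphalf (size s)) uphalf_half.
case: ifPn => os.
  rewrite add1n mkseqS; congr rcons.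
    by apply/eq_in_map => i; rewrite mem_iota add0n /= => /nthE.
  rewrite -[(_./2).*2.+1]add1n odd_halfK// nth_rcons.
  by case: (size s) os => // k _; rewrite add1n ltnn eqxx.
by rewrite add0n; apply/eq_in_map => i; rewrite mem_iota add0n /= => /nthE.
Qed.

Let size_odds s : size (odds s) = (size s)./2.
Proof. by rewrite size_mkseq. Qed.

Let lamc s : R := fine (lam (cylinder s)).

Let lamcE s : lam (cylinder s) = (lamc s)%:E.
Proof. by rewrite fineK// fin_num_measure. Qed.

Let lamc_split s : lamc s = lamc (rcons s false) + lamc (rcons s true).
Proof. by apply: EFin_inj; rewrite EFinD -!lamcE -measure_cylinder. Qed.

(** The weights of a law whose even digits follow [lam] and whose odd digits are
    independent of them and follow the law itself: [weight] unfolds this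
    self-referential description, [n] being fuel; since the odd digits of a
    prefix are fewer, fuel [size s] suffices. *)
Let Fixpoint weight n s : R :=
  if n is m.+1 then lamc (evens s) * weight m (odds s) else 1.

Let weight_nil n : weight n [::] = 1.
Proof.
elim: n => //= n IH; rewrite -[odds [::]]/[::] IH mulr1 -[evens [::]]/[::].
by rewrite /lamc cylinder_nil probability_setT.
Qed.

Let weightS n s : (size s <= n)%N -> weight n.+1 s = weight n s.
Proof.
elim: n s => [|n IH] s sn.
  by move: sn; rewrite leqn0 => /nilP ->; rewrite !weight_nil.
rewrite -[LHS]/(lamc (evens s) * weight n.+1 (odds s)) IH//.
by rewrite size_odds; lia.
Qed.

Let weightE n s : (size s <= n)%N -> weight n s = weight (size s) s.
Proof.
move=> /subnK <-; elim: (n - size s)%N => // k IH.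
by rewrite addSn weightS// leq_addl.
Qed.

(** An additional digit extends either the even or the odd part, and so splits
    exactly one factor. *)
Let weight_split n s : (size s < n)%N ->
  weight n s = weight n (rcons s false) + weight n (rcons s true).
Proof.
elim: n s => // n IH s sn /=; rewrite !evens_rcons !odds_rcons.
case: ifPn => os; last by rewrite -mulrDl -lamc_split.
rewrite -mulrDr -IH// size_odds.
by lia.
Qed.

Let weight_ge0 n s : 0 <= weight n s.
Proof.
by elim: n s => //= n IH s; rewrite mulr_ge0//; exact: fine_ge0.
Qed.

(** The tree measure of [weight].  Its values on cylinders give independence only
    for even and odd prefixes of equal length; the other lengths follow by
    additivity, and general sets by uniqueness, one argument at a time. *)
Let splitting_measure : exists P : probability cantor R, forall S B,
  measurable S -> measurable B ->
  P (zevens @^-1` S `&` zodds @^-1` B) = (lam S * P B)%E.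
Proof.
have [||s|P PE] := @tree_measure R (fun s => weight (size s) s).
- by move=> s; exact: weight_ge0.
- by [].
- rewrite !size_rcons -(@weightE (size s).+1 s)// weight_split//.
exists P.
have mO B : measurable B -> measurable (zodds @^-1` B).
  by move=> mB; rewrite -[X in measurable X]setTI; exact: measurable_zodds.
have mE B : measurable B -> measurable (zevens @^-1` B).
  by move=> mB; rewrite -[X in measurable X]setTI; exact: measurable_zevens.
pose evenm B (mB : measurable B) :=
  image_measure (mrestr P (mO B mB)) measurable_zevens.
pose oddm B (mB : measurable B) :=
  image_measure (mrestr P (mE B mB)) measurable_zodds.
have evenmE B mB S : @evenm B mB S = P (zevens @^-1` S `&` zodds @^-1` B).
  by [].
have oddmE B mB S : @oddm B mB S = P (zevens @^-1` B `&` zodds @^-1` S).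
  by rewrite setIC.
(* Interleaving two prefixes of equal length gives a prefix. *)
have same s t : size s = size t ->
    P (zevens @^-1` cylinder s `&` zodds @^-1` cylinder t) =
    (lam (cylinder s) * P (cylinder t))%E.
  move=> st; pose r := mkseq (fun i => nth false (if odd i then t else s) i./2)
    (size s).*2.
  have sr : size r = (size s).*2 by rewrite size_mkseq.
  have er : evens r = s.
    rewrite /evens sr uphalf_double.
    apply: (@eq_from_nth _ false); rewrite size_mkseq// => i lti.
    by rewrite nth_mkseq// nth_mkseq ?ltn_double// odd_double doubleK.
  have or : odds r = t.
    rewrite /odds sr doubleK st.
    apply: (@eq_from_nth _ false); rewrite size_mkseq// => i lti.
    rewrite nth_mkseq// nth_mkseq ?st ?ltn_Sdouble//.
    by rewrite oddS odd_double/= uphalf_double.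
  rewrite (_ : _ `&` _ = cylinder r).
    rewrite PE lamcE PE -EFinM; congr EFin.
    rewrite sr -st; case sk : (size s) => [|k].
      by rewrite (size0nil sk) /lamc cylinder_nil probability_setT mul1r.
    rewrite doubleS -[weight _ r]/(lamc (evens r) * weight k.*2.+1 (odds r)).
    by rewrite er or weightE -?st ?sk//; lia.
  apply/seteqP; split => z; rewrite /cylinder /=.
    move=> [zs zt]; rewrite sr; apply: (@eq_from_nth _ false).
      by rewrite size_mkseq sr.
    move=> i; rewrite (@size_mkseq bool) => isz.
    have ih : (i./2 < size s)%N by rewrite ltn_half_double.
    rewrite !(@nth_mkseq bool)//; case: ifPn => oi.
      rewrite -[t]zt nth_mkseq -?st// /zodds; congr z.
      by rewrite -[in LHS](odd_double_half i) oi.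
    rewrite -[s in nth _ s]zs nth_mkseq// /zevens; congr z.
    by rewrite even_halfK.
  rewrite sr => zr; split.
    rewrite -[RHS]er /evens sr uphalf_double; apply/eq_in_map => i.
    rewrite mem_iota add0n/= => ilt; rewrite -zr (@nth_mkseq bool)// ltn_double//.
  rewrite -[RHS]or /odds sr doubleK -st; apply/eq_in_map => i.
  by rewrite mem_iota add0n/= => ilt; rewrite -zr (@nth_mkseq bool)// ltn_Sdouble.
have cyl s t : P (zevens @^-1` cylinder s `&` zodds @^-1` cylinder t) =
    (lam (cylinder s) * P (cylinder t))%E.
  (* Split the shorter prefix until the lengths agree. *)
  have lower k : forall s t, (size s + k)%N = size t ->
      P (zevens @^-1` cylinder s `&` zodds @^-1` cylinder t) =
      (lam (cylinder s) * P (cylinder t))%E.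
    elim: k => [|k IH] {}s {}t st; first by rewrite same// -st addn0.
    rewrite -(evenmE _ (measurable_cylinder t)) measure_cylinder !evenmE.
    rewrite !IH ?size_rcons ?addSnnS//.
    by rewrite -ge0_muleDl// -measure_cylinder.
  have upper k : forall s t, (size t + k)%N = size s ->
      P (zevens @^-1` cylinder s `&` zodds @^-1` cylinder t) =
      (lam (cylinder s) * P (cylinder t))%E.
    elim: k => [|k IH] {}s {}t st; first by rewrite same// -st addn0.
    rewrite -(oddmE _ (measurable_cylinder s)) measure_cylinder !oddmE.
    rewrite !IH ?size_rcons ?addSnnS//.
    by rewrite -ge0_muleDr// -measure_cylinder.
  have [st|/ltnW ts] := leqP (size s) (size t).
    by apply: (lower (size t - size s)%N); rewrite subnKC.
  by apply: (upper (size s - size t)%N); rewrite subnKC.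
(* First the set of even digits becomes arbitrary, then that of odd digits. *)
have half S t : measurable S ->
    P (zevens @^-1` S `&` zodds @^-1` cylinder t) = (lam S * P (cylinder t))%E.
  move=> mS; rewrite -(evenmE _ (measurable_cylinder t)).
  have c0 : 0 <= fine (P (cylinder t)) by exact: fine_ge0.
  rewrite (@cylinder_measure_unique _ _ (mscale (NngNum c0) lam))//.
  - transitivity ((fine (P (cylinder t)))%:E * lam S)%E => //.
    by rewrite fineK ?fin_num_measure// muleC.
  - rewrite evenmE; apply: (@le_lt_trans _ _ 1%E); last by rewrite ltry.
    by apply: probability_le1; apply: measurableI; [exact: (mE _)|exact: (mO _)].
  - move=> s; rewrite evenmE cyl.
    transitivity ((fine (P (cylinder t)))%:E * lam (cylinder s))%E => //.
    by rewrite fineK ?fin_num_measure// muleC.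
move=> S B mS mB; rewrite -(oddmE _ mS).
have c0 : 0 <= fine (lam S) by exact: fine_ge0.
rewrite (@cylinder_measure_unique _ _ (mscale (NngNum c0) P))//.
- transitivity ((fine (lam S))%:E * P B)%E => //.
  by rewrite fineK ?fin_num_measure.
- rewrite oddmE; apply: (@le_lt_trans _ _ 1%E); last by rewrite ltry.
  by apply: probability_le1; apply: measurableI; [exact: (mE _)|exact: (mO _)].
- move=> s; rewrite oddmE half//.
  transitivity ((fine (lam S))%:E * P (cylinder s))%E => //.
  by rewrite fineK ?fin_num_measure.
Qed.

(** Peeling off the even digits again and again yields independent coordinates,
    because the remaining odd digits have the law one started from. *)
Lemma infinite_product_measure :
  exists Q : probability (sequence_space cantor) R,
  forall n (S : nat -> set cantor), (forall i, measurable (S i)) ->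
    Q [set u | forall i, (i < n)%N -> S i (u i)] = (\prod_(i < n) lam (S i))%E.
Proof.
have [P PE] := splitting_measure.
pose a (z : cantor) : sequence_space cantor := fun n => zevens (iter n zodds z).
have ma : measurable_fun setT a.
  apply: measurable_fun_sequence => n; apply: (measurableT_comp measurable_zevens).
  elim: n => [|n IH]; first exact: measurable_id.
  exact: (measurableT_comp measurable_zodds IH).
have P1 : image_measure P ma setT = 1%E.
  by rewrite /image_measure /= /pushforward preimage_setT probability_setT.
have [Q QE] := probability_of_measure P1.
exists Q => n S mS; rewrite QE /image_measure /= /pushforward.
elim: n S mS => [|n IH] S mS.
  rewrite big_ord0 (_ : [set _ | _] = setT) ?preimage_setT ?probability_setT//.
  by apply/seteqP; split.
rewrite big_ord_recl -(IH (fun i => S i.+1))//.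
have mB : measurable [set u : sequence_space cantor |
    forall i, (i < n)%N -> S i.+1 (u i)].
  rewrite boxesE; apply: sub_sigma_algebra.
  by exists n, (fun i => S i.+1).
rewrite -PE//; last by rewrite -[X in measurable X]setTI; exact: (ma _).
congr (P _); apply/seteqP; split => z /=.
  by move=> h; split=> [|i lti]; [exact: (h 0%N)|have := h i.+1 lti; rewrite /a iterSr].
by move=> [h0 h] [_|i lti] //; rewrite /a iterSr; exact: h.
Qed.

End infinite_product.

(** * Powers of kernels into the Cantor space *)

Definition cantor_space : mspace := MSpace (@measurableT _ cantor).

Section kernel_measurability.
Context d d' (A : measurableType d) (T : measurableType d') (R : realType).
Variables (D : set A) (k : A -> subprobability T R) (G : set (set T)).
Hypothesis (k1 : forall x, D x -> k x setT = 1%E).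
Hypotheses (GE : measurable = <<s G>>) (GI : setI_closed G).
Hypothesis mG : forall U, G U -> measurable_fun D (fun x => k x U).

Lemma measurable_kernel_generated U : measurable U ->
  measurable_fun D (fun x => k x U).
Proof.
move=> mU; have sU : <<s G>> U by rewrite -GE.
move: U sU {mU}; apply: (dynkin_induction GE GI) => //.
- apply: (eq_measurable_fun (cst 1%E)); first by move=> x /set_mem Dx; rewrite /= k1.
  exact: measurable_cst.
- move=> U mU mkU; apply: (eq_measurable_fun (fun x => 1 - k x U)%E).
    move=> x /set_mem Dx.
    have : k x (setT `\` U) = (k x setT - k x (setT `&` U))%E.
      apply: measureD => //; apply: (@le_lt_trans _ _ 1%E); last exact: ltry.
      by rewrite le_eqVlt; apply/orP; left; apply/eqP; exact: k1.
    by rewrite setTD setTI => ->; congr (_ - _)%E; exact/esym/k1.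
  exact: emeasurable_funB (measurable_cst _) mkU.
- move=> F mF tF mkF.
  apply: (eq_measurable_fun (fun x => \sum_(n <oo) k x (F n))%E).
    by move=> x _; rewrite measure_bigcup//; apply: eq_eseriesl => i; rewrite in_setT.
  exact: ge0_emeasurable_sum.
Qed.

End kernel_measurability.

(** The power measures may be picked separately for every point of the domain:
    their values on boxes are products of measurable functions, which makes the
    family measurable. *)
Lemma power_exists (R : realType) (A : mspace) (f : pkernel R A cantor_space) :
  exists fN, is_power f fN.
Proof.
have H (a : A) : exists Q : subprobability (sequence_space cantor) R, dom f a ->
    Q setT = 1%E /\
    forall n (S : nat -> set cantor), (forall i, measurable (S i)) ->
    Q [set u | forall i, (i < n)%N -> S i (u i)] = (\prod_(i < n) f a (S i))%E.
  have [fa|fa] := pselect (dom f a); last by exists mzero.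
  have [p pE] := probability_of_measure (pk_carrier f fa).
  have [Q QE] := infinite_product_measure p.
  exists Q => _; split; first exact: probability_setT.
  move=> n S mS; apply: etrans (QE n S mS) _.
  by apply: eq_bigr => i _; exact: pE.
have {H} [Q QE] := choice H.
have mQ U : measurable U -> measurable_fun (dom f) (fun a => Q a U).
  apply: (@measurable_kernel_generated _ _ _ _ _ (dom f) Q (@boxes _ cantor)).
  - by move=> a /QE[].
  - exact: boxesE.
  - exact: setI_closed_boxes.
  - move=> _ [n [S [mS ->]]].
    apply: (eq_measurable_fun (fun a => \prod_(i < n) f a (S i))%E).
      by move=> a /set_mem /QE[_ ->].
    elim: n => [|n IH].
      apply: (eq_measurable_fun (cst 1%E)); last exact: measurable_cst.
      by move=> a _; rewrite big_ord0.
    apply: (eq_measurable_fun (fun a => (\prod_(i < n) f a (S i)) * f a (S n))%E).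
      by move=> a _; rewrite big_ord_recr.
    by apply: emeasurable_funM => //; exact: measurable_pk.
have Q1 a : dom f a -> Q a (carrier (mpower cantor_space)) = 1%E.
  move=> /QE[Q1 _]; rewrite -Q1; congr (Q a _).
  by apply/seteqP; split => // u _ n.
exists (@PKernel R A (mpower cantor_space) Q _ (@dom_carrier _ _ _ f)
  (measurable_dom f) mQ Q1).
by split => // a /QE[].
Qed.

(** * Empirical frequencies *)

Section frequency.
Context d (T : measurableType d) (R : realType).
Implicit Types (B : set T) (u : sequence_space T).

(** The observation times grow geometrically, which makes the increments summable
    in mean under an exchangeable measure. *)
Definition frequency B (k : nat) u : R :=
  (4 ^ k)%:R^-1 * \sum_(i < 4 ^ k) \1_B (u i).

Lemma frequency_ge0 B k u : 0 <= frequency B k u.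
Proof. by rewrite mulr_ge0// sumr_ge0. Qed.

Lemma frequency_le1 B k u : frequency B k u <= 1.
Proof.
rewrite /frequency mulrC ler_pdivrMr ?ltr0n ?expn_gt0// mul1r.
rewrite -[leRHS]mulr1 mulr_natl -[(4 ^ k)%N in leRHS]card_ord -sumr_const.
by apply: ler_sum => i _; rewrite indicE lern1 leq_b1.
Qed.

Lemma measurable_frequency B k : measurable B ->
  measurable_fun setT (frequency B k).
Proof.
move=> mB; apply: measurable_funM; first exact: measurable_cst.
apply: measurable_sum => i.
exact: (measurableT_comp (measurable_indic mB) (@measurable_coordinate _ T i)).
Qed.

(** The upper limit is defined, measurable and permutation invariant on all
    sequences, whether the frequencies converge or not. *)
Definition upper_frequency B u : R :=
  fine (limn_esup (fun k => (frequency B k u)%:E)).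

Let limn_esup_frequency01 B u :
  (0 <= limn_esup (fun k => (frequency B k u)%:E) <= 1)%E.
Proof.
rewrite limn_esup_lim; apply/andP; split.
  apply: lime_ge; first exact: is_cvg_esups.
  apply: nearW => n; apply: le_trans (ereal_sup_ubound _); last first.
    by exists n => //=.
  by rewrite lee_fin frequency_ge0.
apply: lime_le; first exact: is_cvg_esups.
apply: nearW => n; apply: ge_ereal_sup => _ [k _ <-].
by rewrite lee_fin frequency_le1.
Qed.

Lemma upper_frequencyE B u :
  limn_esup (fun k => (frequency B k u)%:E) = (upper_frequency B u)%:E.
Proof.
have /andP[h0 h1] := limn_esup_frequency01 B u.
by rewrite fineK// ge0_fin_numE// (le_lt_trans h1)// ltry.
Qed.

Lemma upper_frequency_ge0 B u : 0 <= upper_frequency B u.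
Proof.
by have /andP[h _] := limn_esup_frequency01 B u; rewrite -lee_fin -upper_frequencyE.
Qed.

Lemma upper_frequency_le1 B u : upper_frequency B u <= 1.
Proof.
by have /andP[_ h] := limn_esup_frequency01 B u; rewrite -lee_fin -upper_frequencyE.
Qed.

Lemma measurable_upper_frequency B : measurable B ->
  measurable_fun setT (upper_frequency B).
Proof.
move=> mB; apply/measurable_EFinP.
apply: (eq_measurable_fun (fun u => limn_esup (fun k => (frequency B k u)%:E))).
  by move=> u _; rewrite upper_frequencyE.
apply: measurable_fun_limn_esup => k.
by apply/measurable_EFinP; exact: measurable_frequency.
Qed.

Lemma cvg_upper_frequency B u l : frequency B ^~ u @ \oo --> l ->
  upper_frequency B u = l.
Proof.
move=> ul; apply: EFin_inj; rewrite -upper_frequencyE.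
have ul' : (fun k => (frequency B k u)%:E) @ \oo --> l%:E.
  by apply: cvg_EFin => //; exact: nearW.
by rewrite is_cvg_limn_esupE; [apply/cvg_lim|apply/cvg_ex; exists l%:E].
Qed.

Lemma upper_frequencyT u : upper_frequency setT u = 1.
Proof.
apply: cvg_upper_frequency; rewrite (_ : (fun k => _) = cst 1); first exact: cvg_cst.
apply/funext => k; rewrite /frequency (eq_bigr (fun=> 1)).
  by rewrite sumr_const card_ord mulVf// pnatr_eq0 expn_eq0.
by move=> i _; rewrite indicT.
Qed.

(** A finite permutation maps every long enough initial segment onto itself, so
    it does not change late frequencies at all. *)
Lemma frequency_permute s : finite_permutation s ->
  \forall k \near \oo, forall B u, frequency B k (u \o s) = frequency B k u.
Proof.
move=> [/bij_inj sI fs].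
have [M sM] : exists M, forall n, (M <= n)%N -> s n = n.
  have [r rE] := (@finite_seqP _ _).1 fs; exists (\max_(i <- r) i).+1 => n nM.
  apply/eqP; apply: contraLR nM => sn; rewrite -ltnNge ltnS.
  have nr : n \in r by move: sn; rewrite -[is_true (s n != n)]/([set m | s m != m] n) rE.
  exact: leq_bigmax_seq.
exists M => // k /= Mk B u; congr (_ * _).
have Mk4 : (M <= 4 ^ k)%N by rewrite (leq_trans Mk)// ltnW// ltn_expl.
have sk i : (i < 4 ^ k)%N -> (s i < 4 ^ k)%N.
  rewrite !ltnNge; apply: contra => h.
  by have /sI <- : s (s i) = s i by rewrite sM// (leq_trans Mk4).
pose s' (i : 'I_(4 ^ k)) := Ordinal (sk i (ltn_ord i)).
rewrite [RHS](reindex_inj (h := s'))// => i j [/sI ij].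
exact: val_inj.
Qed.

Lemma upper_frequency_permute s B u : finite_permutation s ->
  upper_frequency B (u \o s) = upper_frequency B u.
Proof.
move=> /frequency_permute[M _ fM]; apply: EFin_inj; rewrite -!upper_frequencyE.
rewrite [RHS]limn_esup_lim; apply/esym; apply: cvg_lim => //.
rewrite limn_esup_lim; apply: cvg_trans (@is_cvg_esups _ _).
apply: near_eq_cvg; exists M => // n /= Mn; rewrite /esups/=; congr ereal_sup.
apply/seteqP; split => _ [k /= nk <-]; exists k => //; rewrite fM//=.
  exact: leq_trans Mn nk.
exact: leq_trans Mn nk.
Qed.

End frequency.

(** * De Finetti's theorem for finite exchangeable measures *)

Definition transpose (i j n : nat) : nat :=
  if n == i then j else if n == j then i else n.

Lemma transposeK i j : involutive (transpose i j).
Proof.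
move=> n; rewrite /transpose; have [->|ni] := eqVneq n i.
  by case: eqVneq => // _; rewrite eqxx.
by have [->|nj] := eqVneq n j; rewrite ?eqxx// (negbTE ni) (negbTE nj).
Qed.

Lemma transposeL i j : transpose i j i = j.
Proof. by rewrite /transpose eqxx. Qed.

Lemma transposeN i j n : n != i -> n != j -> transpose i j n = n.
Proof. by rewrite /transpose => /negbTE -> /negbTE ->. Qed.

Lemma finite_permutation_transpose i j : finite_permutation (transpose i j).
Proof.
split; first by exists (transpose i j); exact: transposeK.
apply: (@sub_finite_set _ _ [set i; j]); last exact: finite_set2.
move=> n /= nij; have [->|ni] := eqVneq n i; first by left.
have [->|nj] := eqVneq n j; first by right.
by rewrite transposeN ?eqxx// in nij.
Qed.

Section de_finetti.
Context d (T : measurableType d) (R : realType).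
Variable nu : {measure set (sequence_space T) -> \bar R}.
Hypothesis nu_fin : (nu setT < +oo)%E.
Hypothesis nu_transpose : forall i j (U : set (sequence_space T)), measurable U ->
  nu [set u : sequence_space T | U (u \o transpose i j)] = nu U.
Implicit Types (B : set T) (u : sequence_space T).

Let measurable_transpose i j :
  measurable_fun setT
    (fun u : sequence_space T => u \o transpose i j : sequence_space T).
Proof. by apply: measurable_fun_sequence => n; exact: measurable_coordinate. Qed.

Let hit B i u : R := \1_B (u i).

Let measurable_hit B i : measurable B -> measurable_fun setT (hit B i).
Proof.
move=> mB.
exact: (measurableT_comp (measurable_indic mB) (@measurable_coordinate _ T i)).
Qed.

Let hit_le1 B i u : hit B i u <= 1.
Proof. by rewrite /hit indicE lern1 leq_b1. Qed.

Let integrable_bounded (g : sequence_space T -> R) (M : R) :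
  measurable_fun setT g -> (forall u, `|g u| <= M) ->
  nu.-integrable setT (EFin \o g).
Proof.
move=> mg gM; apply: measurable_bounded_integrable => //.
exists M; split; first exact: num_real.
by move=> r Mr u _ /=; rewrite (le_trans (gM u))// ltW.
Qed.

Let integral_transpose i j (g : sequence_space T -> R) :
  measurable_fun setT g -> (forall u, 0 <= g u) ->
  \int[nu]_u g (u \o transpose i j) = \int[nu]_u g u.
Proof.
move=> mg g0; congr fine.
pose m' := image_measure nu (@measurable_transpose i j).
transitivity (\int[m']_u (g u)%:E)%E.
  rewrite (@ge0_integral_pushforward _ _ _ _ _ _ (@measurable_transpose i j))//.
  - exact/measurable_EFinP.
  - by move=> u _; rewrite lee_fin.
by apply: eq_measure_integral => A mA _; exact: nu_transpose.
Qed.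

Let hit2 B i j := \int[nu]_u (hit B i u * hit B j u).

Let hit2_transpose B a b i j : measurable B ->
  hit2 B (transpose a b i) (transpose a b j) = hit2 B i j.
Proof.
move=> mB; apply: (@integral_transpose a b (fun u => hit B i u * hit B j u)).
- by apply: measurable_funM; exact: measurable_hit.
- by move=> u; rewrite mulr_ge0.
Qed.

(** Two distinct positions can be moved to 0 and 1 by two transpositions. *)
Let hit2E B i j : measurable B ->
  hit2 B i j = if i == j then hit2 B 0 0 else hit2 B 0 1.
Proof.
move=> mB; have [<-|ij] := eqVneq i j.
  by rewrite -(hit2_transpose i 0 i i mB) transposeL.
rewrite -(hit2_transpose i 0 i j mB) transposeL.
have : transpose i 0 j != 0%N.
  by rewrite -[X in _ != X](transposeL i 0) (inj_eq (can_inj (transposeK _ _))) eq_sym.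
move: (transpose i 0 j) => k k0.
by rewrite -(hit2_transpose k 1 0 k mB) transposeL transposeN// eq_sym.
Qed.

Let integrable_hit2 B i j : measurable B ->
  nu.-integrable setT (EFin \o (fun u => hit B i u * hit B j u)).
Proof.
move=> mB; apply: (@integrable_bounded _ 1).
  by apply: measurable_funM; exact: measurable_hit.
by move=> u; rewrite ger0_norm ?mulr_ge0// mulr_ile1.
Qed.

Let Rintegral_sum n (g : 'I_n -> sequence_space T -> R) :
  (forall i, nu.-integrable setT (EFin \o g i)) ->
  \int[nu]_u (\sum_(i < n) g i u) = \sum_(i < n) \int[nu]_u g i u.
Proof.
move=> ig; rewrite /Rintegral.
under eq_integral do rewrite -sumEFin.
rewrite (@integral_sum _ _ _ nu _ measurableT _ (fun i u => (g i u)%:E))//.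
rewrite (eq_bigr (fun i => (\int[nu]_u g i u)%:E)) ?sumEFin// => i _.
by rewrite /Rintegral fineK//; exact: (integrable_fin_num measurableT (ig i)).
Qed.

(** By exchangeability all mixed second moments agree, so they drop out of the
    square of a combination with coefficients of sum zero. *)
Let centered_square B n (c : nat -> R) : measurable B ->
  \sum_(i < n) c i = 0 ->
  \int[nu]_u (\sum_(i < n) c i * hit B i u) ^+ 2 <=
  (\sum_(i < n) c i ^+ 2) * fine (nu setT).
Proof.
move=> mB c0.
have ii i j : nu.-integrable setT
    (EFin \o (fun u => c i * c j * (hit B i u * hit B j u))).
  have := @integrableZl _ _ _ nu setT measurableT (c i * c j) _ (integrable_hit2 i j mB).
  exact.
have -> : \int[nu]_u (\sum_(i < n) c i * hit B i u) ^+ 2 =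
    \sum_(i < n) \sum_(j < n) c i * c j * hit2 B i j.
  under eq_Rintegral => u _.
    rewrite expr2 big_distrlr/=.
    under eq_bigr => i _ do under eq_bigr => j _ do rewrite mulrACA.
    over.
  rewrite Rintegral_sum.
    apply: eq_bigr => i _; rewrite Rintegral_sum//; apply: eq_bigr => j _.
    by rewrite RintegralZl//; exact: integrable_hit2.
  move=> i; apply: (eq_integrable measurableT
    (fun u => \sum_(j < n) (c i * c j * (hit B i u * hit B j u))%:E)%E).
    by move=> u _; rewrite sumEFin.
  by apply: integrable_sum => //= j _; exact: ii.
have -> : \sum_(i < n) \sum_(j < n) c i * c j * hit2 B i j =
    (\sum_(i < n) c i ^+ 2) * (hit2 B 0 0 - hit2 B 0 1).
  transitivity (\sum_(i < n) (c i * hit2 B 0 1 * (\sum_(j < n) c j) +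
      c i ^+ 2 * (hit2 B 0 0 - hit2 B 0 1))); last first.
    rewrite mulr_suml; apply: eq_bigr => i _.
    by rewrite c0 mulr0 add0r.
  apply: eq_bigr => i _; rewrite (bigD1 i)//= [in RHS](bigD1 i)//= hit2E// eqxx.
  rewrite (eq_bigr (fun j : 'I_n => c i * hit2 B 0 1 * c j)); last first.
    move=> j ji; rewrite hit2E// ifF; first by rewrite mulrAC.
    by apply/negbTE; rewrite eq_sym.
  by rewrite -mulr_sumr; ring.
apply: ler_wpM2l; first by apply: sumr_ge0 => i _; exact: sqr_ge0.
have h1 : hit2 B 0 0 <= fine (nu setT).
  rewrite -[leRHS]mul1r -Rintegral_cst//; apply: le_Rintegral => //.
  - exact: integrable_hit2.
  - by apply: (@integrable_bounded (cst 1) 1) => // u; rewrite normr1.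
  - by move=> u _; rewrite mulr_ile1.
have h2 : 0 <= hit2 B 0 1 by apply: Rintegral_ge0 => u _; rewrite mulr_ge0.
lra.
Qed.

Let increment B k u : R := frequency R B k.+1 u - frequency R B k u.

Let measurable_increment B k : measurable B -> measurable_fun setT (increment B k).
Proof. by move=> mB; apply: measurable_funB; exact: measurable_frequency. Qed.

Let increment_square B k : measurable B ->
  \int[nu]_u (increment B k u ^+ 2) <= (4 ^ k)%:R^-1 * fine (nu setT).
Proof.
move=> mB; set n := (4 ^ k)%N.
have n0 : n%:R != 0 :> R by rewrite pnatr_eq0 expn_eq0.
have n4 : (4 ^ k.+1 = n + 3 * n)%N by rewrite expnS -/n; lia.
(* The coefficients of the difference of the means over 4n and n terms. *)
pose c i : R := (4 * n%:R)^-1 - (if (i < n)%N then n%:R^-1 else 0).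
have sumc (g : R -> R) : \sum_(i < 4 ^ k.+1) g (c i) =
    n%:R * g ((4 * n%:R)^-1 - n%:R^-1) + 3 * n%:R * g (4 * n%:R)^-1.
  rewrite n4 big_split_ord/= (eq_bigr (fun=> g ((4 * n%:R)^-1 - n%:R^-1))); last first.
    by move=> i _; rewrite /c ltn_ord.
  rewrite [X in _ + X](eq_bigr (fun=> g (4 * n%:R)^-1)); last first.
    by move=> i _; rewrite /c ltnNge leq_addr/= subr0.
  rewrite !sumr_const !card_ord.
  by rewrite -[X in X + _ = _]mulr_natl -[X in _ + X = _]mulr_natl natrM.
have cE u : increment B k u = \sum_(i < 4 ^ k.+1) c i * hit B i u.
  rewrite /increment /frequency -/n.
  under [RHS]eq_bigr do rewrite mulrBl.
  rewrite sumrB -mulr_sumr; congr (_ * _ - _).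
    by rewrite expnS natrM.
  rewrite n4 big_split_ord/= [X in _ + X]big1 ?addr0; last first.
    by move=> i _; rewrite ltnNge leq_addr/= mul0r.
  by rewrite mulr_sumr; apply: eq_bigr => i _; rewrite ltn_ord.
under eq_Rintegral => u _ do rewrite cE.
apply: (le_trans (@centered_square B _ c mB _)).
  by rewrite (sumc id); field.
apply: ler_wpM2r; first exact: fine_ge0.
rewrite (sumc (fun x => x ^+ 2)) [leLHS](_ : _ = 3 / 4 * n%:R^-1); last by field.
rewrite ler_piMl ?invr_ge0//.
lra.
Qed.

(** The factor 2^k still leaves a convergent series of integrals, of order 2^-k,
    and converts squares into absolute values: t <= 2^k t^2 + 2^-k. *)
Let summable B u : R^nat := fun k => 2 ^+ k * increment B k u ^+ 2.

Let summable_ge0 B u k : 0 <= summable B u k.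
Proof. by apply: mulr_ge0; [exact: exprn_ge0|exact: sqr_ge0]. Qed.

Let measurable_summable B k : measurable B ->
  measurable_fun setT (fun u => summable B u k).
Proof.
move=> mB; apply: measurable_funM; first exact: measurable_cst.
by apply: measurable_funX; exact: measurable_increment.
Qed.

Let increment_le1 B k u : `|increment B k u| <= 1.
Proof.
have := frequency_ge0 R B k u; have := frequency_le1 R B k u.
have := frequency_ge0 R B k.+1 u; have := frequency_le1 R B k.+1 u.
by rewrite ler_norml /increment; move=> *; apply/andP; split; lra.
Qed.

Let sum_half n : \sum_(0 <= k < n) (2 ^+ k)^-1 <= 2 - 2 * (2 ^+ n)^-1 :> R.
Proof.
elim: n => [|n IH]; first by rewrite big_nil expr0 invr1 mulr1 subrr.
rewrite big_nat_recr//= exprS invfM.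
by move: IH; set x := (2 ^+ n)^-1; lra.
Qed.

Let integral_summable B : measurable B ->
  (\int[nu]_u \sum_(k <oo) (summable B u k)%:E <= (2 * fine (nu setT))%:E)%E.
Proof.
move=> mB; rewrite integral_nneseries//; last 2 first.
- by move=> k; apply/measurable_EFinP; exact: measurable_summable.
- by move=> k u _; rewrite lee_fin.
apply: lime_le.
  apply: is_cvg_nneseries => k _ _.
  by apply: integral_ge0 => u _; rewrite lee_fin.
apply: nearW => n.
apply: (@le_trans _ _ (\sum_(0 <= k < n) ((2 ^+ k)^-1 * fine (nu setT))%:E)%E).
  apply: lee_sum => k _.
  have ib : nu.-integrable setT (EFin \o (fun u => increment B k u ^+ 2)).
    apply: (@integrable_bounded _ 1).
      by apply: measurable_funX; exact: measurable_increment.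
    by move=> u; rewrite normrX exprn_ile1.
  rewrite -[leLHS]fineK; last first.
    apply: (@integrable_fin_num _ _ _ nu _ measurableT
      (EFin \o (fun u => summable B u k))).
    have := @integrableZl _ _ _ nu setT measurableT (2 ^+ k) _ ib.
    exact.
  rewrite lee_fin -/(Rintegral _ _ _) RintegralZl//.
  apply: le_trans (ler_wpM2l _ (increment_square k mB)) _; first exact: exprn_ge0.
  rewrite mulrA; apply: ler_wpM2r; first exact: fine_ge0.
  rewrite natrX (_ : 4%:R = 2 * 2 :> R); last by ring.
  by rewrite exprMn invfM mulVKf// expf_neq0.
rewrite sumEFin lee_fin -mulr_suml; apply: ler_wpM2r; first exact: fine_ge0.
by apply: le_trans (sum_half n) _; rewrite gerBl mulr_ge0.
Qed.

(** A nonnegative series with finite integral is finite almost everywhere; here it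
    dominates the absolute increments up to a geometric series. *)
Lemma ae_cvg_frequency B : measurable B ->
  {ae nu, forall u, frequency R B ^~ u @ \oo --> upper_frequency R B u}.
Proof.
move=> mB.
have int : nu.-integrable setT (fun u => \sum_(k <oo) (summable B u k)%:E)%E.
  apply/integrableP; split.
    apply: ge0_emeasurable_sum => k; first by move=> *; rewrite lee_fin.
    by move=> _; apply/measurable_EFinP; exact: measurable_summable.
  under eq_integral => u _.
    rewrite gee0_abs; last by apply: nneseries_ge0 => k _ _; rewrite lee_fin.
    over.
  by apply: le_lt_trans (integral_summable mB) _; rewrite ltry.
apply: filterS (integrable_ae measurableT int) => u /(_ I) fin.
set M := fine (\sum_(k <oo) (summable B u k)%:E)%E.
have sumM n : \sum_(0 <= k < n) summable B u k <= M.
  rewrite -lee_fin fineK// -sumEFin; apply: nneseries_lim_ge => k _ _.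
  by rewrite lee_fin.
have term k : `|increment B k u| <= summable B u k + (2 ^+ k)^-1.
  rewrite /summable -(real_normK (num_real _)); set x := `|_|.
  have x0 : 0 <= x by exact: normr_ge0.
  have t0 : 0 < 2 ^+ k :> R by rewrite exprn_gt0.
  move: t0; set t := 2 ^+ k => t0.
  have ti : 0 < t^-1 by rewrite invr_gt0.
  have [xt|xt] := leP x t^-1.
    by apply: ler_wpDl => //; apply: mulr_ge0; [exact: ltW|exact: sqr_ge0].
  apply: ler_wpDr; first exact: ltW.
  rewrite expr2 mulrA ler_peMl//.
  by rewrite -(mulfV (lt0r_neq0 t0)) ler_pM2l// ltW.
have cvg_inc : cvgn (series (fun k => increment B k u)).
  apply: normed_cvg; apply: nondecreasing_is_cvgn.
    by apply: nondecreasing_series => k _ _; exact: normr_ge0.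
  exists (M + 2) => _ [n _ <-]; rewrite /series/=.
  apply: le_trans (ler_sum _ (fun k _ => term k)) _; rewrite big_split/=.
  apply: lerD (sumM n) _; apply: le_trans (sum_half n) _.
  by rewrite gerBl mulr_ge0.
have cvg_freq : cvgn (frequency R B ^~ u).
  rewrite (_ : frequency R B ^~ u = cst (frequency R B 0 u) \+
      series (telescope (frequency R B ^~ u))).
    by apply: is_cvgD => //; exact: is_cvg_cst.
  by apply/funext => n; exact: (eq_sum_telescope (frequency R B ^~ u)).
by rewrite (@cvg_upper_frequency _ _ _ _ _ (limn (frequency R B ^~ u))).
Qed.

(** Induction on the number [m] of coordinate indicators already replaced by
    limiting frequencies.  In the induction step, let [G] be the product of the
    factors other than the one of index [m].  [G] does not change if [m] is
    transposed with a position beyond [n], hence the integral of [G] times the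
    indicator at position [i] does not depend on [i] beyond [n]; averaging over
    [i] and letting the number of positions grow replaces the indicator by the
    limiting frequency. *)
Lemma expectation_upper_frequency n (B : nat -> set T) :
  (forall i, measurable (B i)) ->
  (\int[nu]_u (\prod_(j < n) upper_frequency R (B j) u)%:E =
   nu [set u | forall j, (j < n)%N -> B j (u j)])%E.
Proof.
move=> mB.
pose factor m j u := if (j < m)%N then upper_frequency R (B j) u else hit (B j) j u.
have factor01 m j u : 0 <= factor m j u <= 1.
  rewrite /factor; case: ifPn => _; apply/andP; split => //.
    exact: upper_frequency_ge0.
  exact: upper_frequency_le1.
have mfactor m j : measurable_fun setT (factor m j).
  rewrite /factor; case: (j < m)%N; last exact: measurable_hit.
  exact: measurable_upper_frequency.
suff H m : (m <= n)%N -> (\int[nu]_u (\prod_(j < n) factor m j u)%:E =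
    nu [set u | forall j, (j < n)%N -> B j (u j)])%E.
  rewrite -(H n (leqnn n)); apply: eq_integral => u _; congr EFin.
  by apply: eq_bigr => j _; rewrite /factor ltn_ord.
elim: m => [_|m IH mn].
  pose box := [set u : sequence_space T | forall j, (j < n)%N -> B j (u j)].
  have mbox : measurable box.
    by rewrite boxesE; apply: sub_sigma_algebra; exists n, B.
  transitivity (\int[nu]_u (\1_box u)%:E)%E; last by rewrite integral_indic// setIT.
  apply: eq_integral => u _; congr EFin; rewrite /factor/= /hit.
  rewrite indicE; have [ub|ub] := boolP (u \in box).
    by apply: big1 => j _; rewrite indicE mem_set//; move/set_mem: ub; exact.
  have [j /not_implyP[jn uj]] : exists j, ~ ((j < n)%N -> B j (u j)).
    by apply/existsNP; move: ub; rewrite notin_setE.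
  by rewrite (bigD1 (Ordinal jn))//= indicE memNset ?mul0r.
rewrite -(IH (ltnW mn)).
pose om := Ordinal mn.
pose G u := \prod_(j < n | j != om) factor m j u.
have G0 u : 0 <= G u by apply: prodr_ge0 => j _; case/andP: (factor01 m j u).
have G1 u : G u <= 1 by apply: prodr_ile1 => j _; exact: factor01.
have mG : measurable_fun setT G.
  rewrite (_ : G = fun u => \prod_(j < n) (if j != om then factor m j u else 1)).
    apply: measurable_prod => j _; case: (j != om); first exact: mfactor.
    exact: measurable_cst.
  by apply/funext => u; rewrite /G big_mkcond.
pose a i := \int[nu]_u (G u * hit (B m) i u).
have mGh i : measurable_fun setT (fun u => G u * hit (B m) i u).
  by apply: measurable_funM => //; exact: measurable_hit.
have iGh i : nu.-integrable setT (EFin \o (fun u => G u * hit (B m) i u)).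
  apply: (@integrable_bounded _ 1) => // u.
  by rewrite ger0_norm ?mulr_ge0// mulr_ile1.
have aE i : (n <= i)%N -> a i = a m.
  move=> ni; rewrite /a -(@integral_transpose m i)//; last by move=> u; rewrite mulr_ge0.
  apply: eq_Rintegral => u _; congr (_ * _).
    apply: eq_bigr => j jm; rewrite /factor; case: ifPn => _.
      exact/upper_frequency_permute/finite_permutation_transpose.
    rewrite /hit/= transposeN//.
    by apply: contraTneq (ltn_ord j) => ->; rewrite -leqNgt.
  by rewrite /hit /transpose /= eqxx; case: eqVneq => // ->.
have cvga : (fun k => (4 ^ k)%:R^-1 * \sum_(i < 4 ^ k) a i) @ \oo --> a m.
  have am : a @ \oo --> a m.
    by apply: cvg_near_cst; exists n => // i /= ni; rewrite aE.
  have h4 : (fun k => (4 ^ k).-1) @ \oo --> \oo.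
    apply/cvgnyPge => A; exists A => // k /= Ak.
    by have := ltn_expl k (isT : (1 < 4)%N); lia.
  have := cvg_comp _ _ h4 (cesaro am); apply: cvg_trans; apply: near_eq_cvg.
  apply: nearW => k /=; rewrite /arithmetic_mean /= prednK ?expn_gt0//.
  by rewrite /series/= big_mkord.
have E1 : (\int[nu]_u (\prod_(j < n) factor m j u)%:E = (a m)%:E)%E.
  rewrite /a /Rintegral fineK; last exact: (integrable_fin_num measurableT (iGh m)).
  apply: eq_integral => u _; congr EFin; rewrite (bigD1 om)//= mulrC.
  by congr (_ * _); rewrite /factor ltnn.
have E2 : (\int[nu]_u (\prod_(j < n) factor m.+1 j u)%:E =
    \int[nu]_u (G u * upper_frequency R (B m) u)%:E)%E.
  apply: eq_integral => u _; congr EFin; rewrite (bigD1 om)//= mulrC.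
  congr (_ * _); last by rewrite /factor ltnSn.
  apply: eq_bigr => j jm; rewrite /factor ltnS leq_eqVlt.
  by rewrite [X in X || _](_ : _ = false)//; apply/negbTE.
rewrite E1 E2.
have mF k : measurable_fun setT (fun u => (G u * frequency R (B m) k u)%:E).
  by apply/measurable_EFinP/measurable_funM => //; exact: measurable_frequency.
have mF' : measurable_fun setT (fun u => (G u * upper_frequency R (B m) u)%:E).
  by apply/measurable_EFinP/measurable_funM => //; exact: measurable_upper_frequency.
have cvgF : {ae nu, forall u, setT u ->
    (fun k => (G u * frequency R (B m) k u)%:E) @ \oo -->
    (G u * upper_frequency R (B m) u)%:E}.
  apply: filterS (ae_cvg_frequency (mB m)) => u cu _.
  by apply: cvg_EFin; [exact: nearW|apply: cvgM => //; exact: cvg_cst].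
have i1 : nu.-integrable setT (cst 1%E).
  by apply: (@integrable_bounded (cst 1) 1) => // u; rewrite normr1.
have leF : {ae nu, forall u k, setT u ->
    `|(G u * frequency R (B m) k u)%:E| <= cst 1 u}%E.
  apply: aeW => u k _; rewrite /= lee_fin ger0_norm.
    by rewrite mulr_ile1 ?frequency_ge0 ?frequency_le1.
  by rewrite mulr_ge0// frequency_ge0.
have [_ _ dct] := dominated_convergence measurableT mF mF' cvgF i1 leF.
have FE k : (\int[nu]_u (G u * frequency R (B m) k u)%:E =
    ((4 ^ k)%:R^-1 * \sum_(i < 4 ^ k) a i)%:E)%E.
  have iGF : nu.-integrable setT (EFin \o (fun u => G u * frequency R (B m) k u)).
    apply: (@integrable_bounded _ 1); first by apply/measurable_EFinP; exact: mF.
    move=> u; rewrite ger0_norm; first by rewrite mulr_ile1 ?frequency_ge0 ?frequency_le1.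
    by rewrite mulr_ge0// frequency_ge0.
  rewrite -[LHS](fineK (integrable_fin_num measurableT iGF)); congr EFin.
  rewrite -Rintegral_sum// -RintegralZl//.
    by apply: eq_Rintegral => u _; rewrite /frequency -mulr_sumr mulrCA.
  apply: (eq_integrable measurableT
    (fun u => \sum_(i < 4 ^ k) (G u * hit (B m) i u)%:E)%E).
    by move=> u _; rewrite sumEFin.
  by apply: integrable_sum => //= i _; exact: iGh.
apply: (cvg_unique _ dct) => //; rewrite /= (funext FE).
by apply: cvg_EFin; [exact: nearW|exact: cvga].
Qed.

End de_finetti.

(** * Standard Borel spaces as retracts of the Cantor space *)

Section metric_retract.
Context (R : realType) (P : metricType R).
Hypothesis P_complete : forall F : set_system P,
  ProperFilter F -> cauchy F -> exists p : P, F --> p.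
Variables (S : set P) (p0 : P).
Hypotheses (countableS : countable S) (denseS : dense S).

Let r (k : nat) : R := (2 ^+ k)^-1.

Let r_gt0 k : 0 < r k. Proof. by rewrite invr_gt0 exprn_gt0. Qed.

Let rS k : r k = 2 * r k.+1.
Proof. by rewrite /r exprS invfM mulrA mulfV ?mul1r. Qed.

Let r_small (e : R) : 0 < e -> exists k, r k < e.
Proof.
move=> e0; have ei : 0 < e^-1 by rewrite invr_gt0.
have en := archi_boundP (ltW ei); set n := Num.bound _ in en.
exists n; rewrite -[e]invrK /r ltf_pV2 ?posrE ?exprn_gt0//.
by rewrite (lt_trans en)// -natrX ltr_nat ltn_expl.
Qed.

Let open_disk (x : P) (e : R) : open [set y : P | mdist x y < e].
Proof.
rewrite openE => y /= xy; apply/nbhs_ballP.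
exists (e - mdist x y); first by rewrite /= subr_gt0.
move=> z; rewrite ballEmdist/= ltrBrDl.
by apply: le_lt_trans; exact: metric_triangle.
Qed.

Let dense_sequence : exists e : nat -> P, forall p (eps : R), 0 < eps ->
  exists i, mdist (e i) p < eps.
Proof.
have [f injf] := countable_injP _ countableS.
have /choice[e eP] : forall n, exists q, forall s, S s -> f s = n -> q = s.
  move=> n; have [[s [Ss fs]]|h] := pselect (exists s, S s /\ f s = n).
    by exists s => t St ft; apply: injf; rewrite ?inE// fs ft.
  by exists p0 => s Ss fs; exfalso; apply: h; exists s.
exists e => p eps eps0.
have [||s [/= ps Ss]] := denseS (O := [set y | mdist p y < eps]).
- by exists p; rewrite /= mdistxx.
- exact: open_disk.
by exists (f s); rewrite (eP _ _ Ss erefl) metric_sym.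
Qed.

(** A point [p] is coded by the small balls around the points [e i] of a dense
    sequence that contain it.  To decode a binary sequence, take for each radius
    the first ball it mentions: if consecutive centres are close, the centres
    converge, and the limit is the decoded point.  The decoding is measurable
    because the limit lies in an open set iff some ball around one of the
    centres, taken large enough to be sure to contain the limit, is included in
    that set. *)
Lemma metric_retract : exists (O : nat -> set P) (L : cantor -> P),
  [/\ forall n, open (O n),
      forall B, <<s [set U : set P | open U] >> B -> measurable (L @^-1` B) &
      forall p, L (fun n => `[< O n p >]) = p].
Proof.
have [e eP] := dense_sequence.
pose O n := if unpickle n is Some ik then
  [set p : P | mdist (e (ik : nat * nat).1) p < r ik.2] else set0.
have OE i k : O (pickle (i, k)) = [set p | mdist (e i) p < r k].
  by rewrite /O pickleK.
have openO n : open (O n).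
  rewrite /O; case: unpickle => [[i k]|]; [exact: open_disk|exact: open0].
pose Z (k i : nat) : set cantor := [set z : cantor | z (pickle (i, k))].
have mZ k i : measurable (Z k i).
  rewrite -[X in measurable X]setTI.
  exact: (@measurable_coordinate _ bool (pickle (i, k)) measurableT [set true]).
pose idx (k : nat) (z : cantor) : nat :=
  if pselect (exists i : nat, z (pickle (i, k))) is left h then ex_minn h else 0%N.
have idxP k z i : Z k i z -> Z k (idx k z) z.
  by move=> zi; rewrite /idx; case: pselect => [h|[]]; [case: ex_minnP|exists i].
have m_idx k (A : set nat) : measurable (idx k @^-1` A).
  rewrite (_ : _ @^-1` _ = \bigcup_(i in A) (idx k @^-1` [set i])); last first.
    by apply/seteqP; split=> [z Az|z [i Ai /= zi]]; [exists (idx k z)|rewrite /= zi].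
  apply: bigcup_measurable => i _.
  rewrite (_ : _ @^-1` _ = (Z k i `\` \bigcup_(i' in [set i' | (i' < i)%N]) Z k i') `|`
    (if i == 0%N then ~` \bigcup_i' Z k i' else set0)).
    apply: measurableU; first by apply: measurableD => //; exact: bigcup_measurable.
    by case: ifP => // _; apply: measurableC; exact: bigcup_measurable.
  apply/seteqP; split=> z.
    move=> /= <-; rewrite /idx; case: pselect => [h|h]; last first.
      by right => -[i' _ zi']; apply: h; exists i'.
    case: ex_minnP => m zm mmin; left; split => // -[i' /= lti' zi'].
    by have := mmin _ zi'; rewrite leqNgt lti'.
  move=> [[zi lti]|].
    rewrite /= /idx; case: pselect => [h|[]]; last by exists i.
    case: ex_minnP => m zm mmin; apply/eqP; rewrite eqn_leq mmin//= leqNgt.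
    by apply/negP => mi; apply: lti; exists m.
  case: eqP => // -> h; rewrite /= /idx; case: pselect => // -[i' zi'].
  by exfalso; apply: h; exists i'.
(* Consecutive centres of a code are at distance less than r k + r k.+1; the
   bound 2 * r k sums to 4 * r k, and the limit is within 5 * r k. *)
pose q k z := e (idx k z).
pose good := [set z : cantor | forall k, mdist (q k z) (q k.+1 z) < 2 * r k].
have mgood : measurable good.
  rewrite (_ : good = \bigcap_k \bigcup_i (idx k @^-1` [set i] `&`
      idx k.+1 @^-1` [set i' | mdist (e i) (e i') < 2 * r k])).
    apply: bigcapT_measurable => k; apply: bigcup_measurable => i _.
    by apply: measurableI; exact: m_idx.
  apply/seteqP; split => z /= h k.
    by move=> _; exists (idx k z) => //; split => //; exact: h.
  by have [i _ [/= <-]] := h k I.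
have near_q z k n : good z -> mdist (q k z) (q (k + n)%N z) <= 4 * r k - 4 * r (k + n)%N.
  move=> gz; elim: n => [|n IH]; first by rewrite addn0 mdistxx subrr.
  apply: le_trans (metric_triangle _ (q (k + n)%N z) _) _.
  by rewrite addnS; have := gz (k + n)%N; have := rS (k + n); lra.
have ex_lim z : good z -> exists p, forall k, mdist (q k z) p < 5 * r k.
  move=> gz.
  have cau : cauchy ((fun k => q k z) @ \oo).
    apply: cauchy_exP => eps eps0.
    have [k rk] := @r_small (eps / 4) (divr_gt0 eps0 (ltr0n _ 4)).
    exists (q k z); exists k => // m /= km; rewrite ballEmdist/= -(subnKC km).
    apply: le_lt_trans (near_q _ _ _ gz) _.
    by have := r_gt0 (k + (m - k)); lra.
  have [p qp] := P_complete _ cau.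
  exists p => k; have [N _ NP] := qp _ (nbhsx_ballx p (r k) (r_gt0 k)).
  have := NP (k + N)%N (leq_addl _ _); rewrite ballEmdist/= metric_sym => h.
  apply: le_lt_trans (metric_triangle _ (q (k + N)%N z) _) _.
  by have := near_q z k N gz; have := r_gt0 (k + N); lra.
have [L LP] : exists L : cantor -> P, forall z,
    (good z -> forall k, mdist (q k z) (L z) < 5 * r k) /\ (~ good z -> L z = p0).
  suff /choice[L LP] : forall z : cantor, exists p,
      (good z -> forall k, mdist (q k z) p < 5 * r k) /\ (~ good z -> p = p0).
    by exists L.
  by move=> z; have [/[dup] gz /ex_lim[p pP]|gz] := pselect (good z);
    [exists p|exists p0].
exists O, L; split => //.
- have mL : <<s [set U : set P | open U] >> `<=` [set B | measurable (L @^-1` B)].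
    apply: smallest_sub.
      split => [|B /= mB|F /= mF].
      + by rewrite /= preimage_set0.
      + by rewrite setTD preimage_setC; exact: measurableC.
      + by rewrite preimage_bigcup; exact: bigcupT_measurable.
    move=> U /= oU.
    rewrite (_ : L @^-1` U = (good `&` \bigcup_k (idx k @^-1`
        [set i | [set p | mdist (e i) p < 5 * r k] `<=` U])) `|`
        (if `[< U p0 >] then ~` good else set0)).
      apply: measurableU.
        by apply: measurableI => //; apply: bigcupT_measurable => k; exact: m_idx.
      by case: ifP => // _; exact: measurableC.
    apply/seteqP; split=> z /=.
      have [gz ULz|gz] := pselect (good z); last first.
        by rewrite (LP z).2// => Up0; right; rewrite asboolT.
      left; split => //.
      have := open_nbhs_nbhs (conj oU ULz).
      move=> /nbhs_ballP[eps /= eps0 epsU].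
      have [k rk] := @r_small (eps / 10) (divr_gt0 eps0 (ltr0n _ 10)).
      exists k => // p /= qp; apply: epsU; rewrite ballEmdist/=.
      apply: le_lt_trans (metric_triangle _ (q k z) _) _.
      have := (LP z).1 gz k; rewrite metric_sym; move: qp; rewrite -/(q k z).
      by lra.
    move=> [[gz [k _ /= qU]]|]; first by apply: qU; exact: (LP z).1.
    by case: ifPn => // /asboolP Up0 gz; rewrite (LP z).2.
  by move=> B /mL.
- move=> p; set z : cantor := fun n => `[< O n p >].
  have qp k : mdist (q k z) p < r k.
    have [i ip] := eP p _ (r_gt0 k).
    have : Z k (idx k z) z by apply: (idxP k z i); rewrite /Z/= /z OE; apply/asboolP.
    by rewrite /Z/= /z OE => /asboolP.
  have gz : good z.
    move=> k; apply: le_lt_trans (metric_triangle _ p _) _.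
    by have := qp k; have := qp k.+1; rewrite (metric_sym (q k.+1 z)); have := rS k;
      have := r_gt0 k.+1; lra.
  apply/esym; apply: mdist_positivity; apply/eqP; rewrite eq_le mdist_ge0 andbT.
  apply/ler_addgt0Pl => eps eps0; rewrite addr0.
  have [k rk] := @r_small (eps / 6) (divr_gt0 eps0 (ltr0n _ 6)).
  apply: le_trans (metric_triangle _ (q k z) _) _.
  by have := (LP z).1 gz k; have := qp k; rewrite (metric_sym (q k z) p); lra.
Qed.

End metric_retract.

(** The Borel isomorphism [j] transports the coding of the metric space: images of
    open sets are measurable, and preimages of measurable sets are Borel. *)
Lemma standard_borel_retract (R : realType) (X : mspace) :
  standard_borel R X -> carrier X !=set0 ->
  exists (phi : X -> cantor) (psi : cantor -> X),
    [/\ measurable_fun setT phi, measurable_fun setT psi,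
        forall x, carrier X x -> psi (phi x) = x &
        forall z, carrier X (psi z)].
Proof.
move=> [P [j [compl [S cS dS] injj jX jB]]] [x0 Xx0].
have [p0 _ jp0] : range j x0 by rewrite jX.
have [D [L [oO mL OL]]] := metric_retract compl p0 cS dS.
exists (fun x n => `[< (j @` D n) x >]), (fun z => j (L z)); split.
- apply: measurable_fun_sequence => n.
  apply: (@measurable_fun_bool _ _ _ _ true).
  rewrite setTI (_ : _ @^-1` _ = j @` D n).
    by apply/jB; apply: sub_sigma_algebra; exact: oO.
  by apply/seteqP; split => x /= /asboolP.
- move=> _ A mA; rewrite setTI; apply: (mL (j @^-1` A)); apply/jB.
  rewrite (_ : _ @` _ = A `&` carrier X).
    by apply: measurableI => //; exact: measurable_carrier.
  apply/seteqP; split => [_ [p Ajp <-]|x [Ax]].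
    by split => //; rewrite -jX; exists p.
  by rewrite -jX => -[p _ jp]; exists p => //=; rewrite jp.
- move=> x; rewrite -jX => -[p _ <-]; rewrite -[in RHS](OL p); congr (j (L _)).
  apply/funext => n; apply/asboolP/asboolP; last by move=> Op; exists p.
  by move=> [q Oq /injj <-].
- by move=> z; rewrite -jX; exists (L z).
Qed.

(** * Preliminaries on measures and partial kernels *)

Section generated_boxes.
Context d (T : measurableType d) (G : set (set T)).
Hypotheses (GE : measurable = <<s G>>) (GI : setI_closed G) (GT : G setT).

Definition generated_boxes : set (set (sequence_space T)) :=
  [set B | exists (n : nat) (S : nat -> set T), (forall i, G (S i)) /\
    B = [set u | forall i, (i < n)%N -> S i (u i)]].

Lemma generated_boxesE : measurable = <<s generated_boxes>>.
Proof.
apply/seteqP; split; last first.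
  apply: smallest_sub; first exact: sigma_algebra_measurable.
  move=> _ [n [S [GS ->]]]; rewrite boxesE; apply: sub_sigma_algebra.
  exists n, S; split => // i; rewrite GE; exact: sub_sigma_algebra.
apply: smallest_sub; first exact: smallest_sigma_algebra.
move=> _ [n _ [A mA <-]]; rewrite setTI.
suff : <<s G>> `<=` [set A | <<s generated_boxes>>
    [set u : sequence_space T | A (u n)]] by rewrite GE in mA; apply.
apply: smallest_sub.
  split => [|B /= mB|F /= mF].
  - by have [h _ _] := smallest_sigma_algebra setT generated_boxes; exact: h.
  - have [_ h _] := smallest_sigma_algebra setT generated_boxes.
    have := h _ mB; rewrite (_ : setT `\` _ = [set u | (setT `\` B) (u n)])//.
  - have [_ _ h] := smallest_sigma_algebra setT generated_boxes.
    have := h _ mF; rewrite (_ : \bigcup_k _ = [set u | (\bigcup_k F k) (u n)])//.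
move=> B GB; apply: sub_sigma_algebra.
exists n.+1, (fun i => if i == n then B else setT); split.
  by move=> i; case: ifP.
apply/seteqP; split => u /=; first by move=> Bu i _; case: eqP => // ->.
by move=> /(_ n (ltnSn n)); rewrite eqxx.
Qed.

Lemma setI_closed_generated_boxes : setI_closed generated_boxes.
Proof.
move=> _ _ [n [S [GS ->]]] [m [S' [GS' ->]]].
exists (maxn n m), (fun i => (if (i < n)%N then S i else setT) `&`
                             (if (i < m)%N then S' i else setT)); split.
  by move=> i; apply: GI; case: ifP.
apply/seteqP; split => u /=.
  move=> [Su S'u] i _; split; case: ifPn => // im; [exact: Su|exact: S'u].
by move=> H; split => i im; have := H i; rewrite leq_max im ?orbT => /(_ isT) [].
Qed.

End generated_boxes.

Section measure_helpers.
Context d (T : measurableType d) (R : realType) (m : {measure set T -> \bar R}).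

Lemma measure_concentrated (C A : set T) : measurable C -> m (~` C) = 0%E ->
  measurable A -> m (A `&` C) = m A.
Proof.
move=> mC mC0 mA; rewrite [RHS](@measureDI _ _ _ m A C)//.
rewrite [X in (X + _)%E](_ : _ = 0%E) ?add0e//.
apply/eqP; rewrite eq_le measure_ge0 andbT -mC0; apply: le_measure.
- by rewrite inE; exact: measurableD.
- by rewrite inE; exact: measurableC.
- by move=> x [].
Qed.

(** On [E `&` D] the restricted measure is the measure itself, on [E `\` D] it
    vanishes. *)
Lemma ge0_integral_mrestr (D E : set T) (mD : measurable D) (f : T -> \bar R) :
  measurable E -> measurable_fun E f -> (forall x, 0 <= f x)%E ->
  (\int[mrestr m mD]_(x in E) f x = \int[m]_(x in E `&` D) f x)%E.
Proof.
move=> mE mf f0; rewrite -[in LHS](setUIDK E D).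
rewrite ge0_integral_setU//=.
- rewrite [X in (_ + X)%E](_ : _ = 0%E) ?adde0.
    apply: eq_measure_integral => A mA AED; rewrite -[LHS]/(m (A `&` D)).
    by rewrite setIidl// => x /AED[].
  rewrite (@eq_measure_integral _ _ _ _ mzero) ?integral_measure_zero// => A mA AED.
  rewrite -[LHS]/(m (A `&` D)) (_ : _ `&` _ = set0) ?measure0//.
  by apply/seteqP; split => // x [/AED[]].
- exact: measurableI.
- exact: measurableD.
- by rewrite setUIDK.
- by apply/disj_set2P; rewrite setDE setIACA setICr setI0.
Qed.

End measure_helpers.

Section mixture.
Context (R : realType) (X Y : mspace) (g : pkernel R X Y).
Variable nu : {measure set X -> \bar R}.

Let mixture (U : set Y) : \bar R := (\int[nu]_(x in dom g) g x U)%E.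

Let mixture0 : mixture set0 = 0%E.
Proof. by apply: integral0_eq => y _; rewrite measure0. Qed.

Let mixture_ge0 U : (0 <= mixture U)%E.
Proof. exact: integral_ge0. Qed.

Let mixture_sigma_additive : semi_sigma_additive mixture.
Proof.
move=> F mF tF mUF; rewrite [X in _ --> X](_ : _ =
    \sum_(n <oo) mixture (F n))%E.
  by apply/cvg_closeP; split; [exact: is_cvg_nneseries|rewrite closeE].
rewrite -integral_nneseries//.
- apply: eq_integral => y _; apply/esym/cvg_lim => //.
  exact: measure_semi_sigma_additive.
- exact: measurable_dom.
- by move=> n; exact: measurable_pk.
Qed.

HB.instance Definition _ := isMeasure.Build _ _ _ mixture
  mixture0 mixture_ge0 mixture_sigma_additive.

Definition mixture_measure : {measure set Y -> \bar R} := mixture.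

End mixture.

Section pkernel_lemmas.
Variable R : realType.

Lemma pk_setT (X Y : mspace) (f : pkernel R X Y) x : dom f x -> f x setT = 1%E.
Proof.
move=> fx; apply/eqP; rewrite eq_le sprobability_setT/= -(pk_carrier f fx).
by apply: le_measure; rewrite ?inE//; exact: measurable_carrier.
Qed.

Lemma pk_carrierC (X Y : mspace) (f : pkernel R X Y) x :
  dom f x -> f x (~` carrier Y) = 0%E.
Proof.
move=> fx; have mC := measurable_carrier Y.
have : f x (setT `\` carrier Y) = (f x setT - f x (setT `&` carrier Y))%E.
  apply: measureD => //; apply: (@le_lt_trans _ _ 1%E); last exact: ltry.
  exact: sprobability_setT.
rewrite setTD setTI => ->; apply: etrans (subee (x := 1%E) _) => //.
by congr (_ - _)%E; [exact: pk_setT|exact: pk_carrier].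
Qed.

Section after_deterministic.
Variables (X Y Z : mspace) (h : Y -> Z) (f : pkernel R X Y).
Hypotheses (mh : measurable_fun setT h) (hYZ : forall y, carrier Y y -> carrier Z (h y)).

Lemma dom_pkcomp_pkdet : dom (pkcomp (pkdet R mh hYZ) f) = dom f.
Proof.
by apply/seteqP; split => x; [move=> []|move=> fx; split => //; exact: pk_carrier].
Qed.

Lemma pkcomp_pkdetE x U : dom f x -> measurable U ->
  pkcomp (pkdet R mh hYZ) f x U = f x (h @^-1` U).
Proof.
move=> fx mU; have mhU : measurable (h @^-1` U).
  by rewrite -[X in measurable X]setTI; exact: mh.
have mC := measurable_carrier Y.
rewrite -[RHS](measure_concentrated mC (pk_carrierC fx) mhU).
by rewrite -integral_indic//; exact: eq_integral.
Qed.

End after_deterministic.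

End pkernel_lemmas.

(** * Slices of a joint law *)

Section slices.
Variables (R : realType) (A X Y : mspace) (f : pkernel R A (mprod X Y)).
Variables (a : A) (fa : dom f a).

Let mband (T : set Y) : measurable T ->
  measurable (setT `*` (T `&` carrier Y) : set (mprod X Y)).
Proof.
move=> mT; apply: measurableX => //; apply: measurableI => //.
exact: measurable_carrier.
Qed.

(** S |-> f(S x T | a).  The intersection with the carrier of [Y] is the domain
    condition that composition with the identity of [Y] imposes. *)
Definition slice (T : set Y) (mT : measurable T) : {measure set X -> \bar R} :=
  image_measure (mrestr (f a) (mband mT)) (@measurable_fst _ _ X Y).

Variables (T : set Y) (mT : measurable T).

Lemma sliceE S : slice mT S = f a (S `*` (T `&` carrier Y)).
Proof.
rewrite -[LHS]/(f a ((fst @^-1` S) `&` (setT `*` (T `&` carrier Y)))).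
by congr (f a _); apply/seteqP; split => -[x y] /= [] // ? [].
Qed.

Lemma slice_rect S : measurable S -> slice mT S = f a (S `*` T).
Proof.
move=> mS; rewrite sliceE.
have mC := measurable_carrier (mprod X Y).
have mCY := measurable_carrier Y.
have m1 : measurable (S `*` (T `&` carrier Y) : set (mprod X Y)).
  by apply: measurableX => //; exact: measurableI.
have m2 : measurable (S `*` T : set (mprod X Y)) by exact: measurableX.
rewrite -[LHS](measure_concentrated mC (pk_carrierC fa) m1).
rewrite -[RHS](measure_concentrated mC (pk_carrierC fa) m2).
congr (f a _); apply/seteqP; split => -[x y] /=.
  by move=> [[Sx [Ty _]] []].
by move=> [[Sx Ty] [Xx Yy]].
Qed.

Lemma slice_lty : (slice mT setT < +oo)%E.
Proof.
apply: (@le_lt_trans _ _ 1%E); last exact: ltry.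
rewrite slice_rect//; apply: le_trans (@sprobability_setT _ _ _ (f a)).
by apply: le_measure; rewrite ?inE//; exact: measurableX.
Qed.

Lemma slice_carrierC : slice mT (~` carrier X) = 0%E.
Proof.
have mCX := measurable_carrier X.
have mnCX : measurable (~` carrier X) by exact: measurableC.
rewrite slice_rect//; apply/eqP; rewrite eq_le measure_ge0 andbT.
rewrite -(pk_carrierC fa); apply: le_measure; rewrite ?inE.
- exact: measurableX.
- by apply: measurableC; exact: measurable_carrier.
- by move=> -[x y] /= [nXx _] [].
Qed.

Lemma pkcomp_tensor_rect (Z : mspace) (g : pkernel R X Z) S : measurable S ->
  pkcomp (pktensor g (pkid R Y)) f a (S `*` T) =
  (\int[slice mT]_(x in dom g) g x S)%E.
Proof.
move=> mS; have mg := measurable_dom g; have mCY := measurable_carrier Y.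
have mgS := measurable_pk g mS.
have mfst : measurable_fun setT (@fst X Y) by exact: measurable_fst.
have mfg : measurable (fst @^-1` dom g : set (X * Y)).
  by rewrite -[X in measurable X]setTI; exact: mfst.
have mgfst : measurable_fun (fst @^-1` dom g : set (X * Y)) (fun p => g p.1 S).
  apply: (@measurable_comp _ _ _ _ _ _ (dom g) (fun x => g x S) _ fst) => //.
    by move=> _ [p gp <-].
  exact: measurable_funTS.
rewrite (@ge0_integral_pushforward _ _ _ _ _ _ mfst)//.
rewrite (@ge0_integral_mrestr _ _ _ (f a) _ _ (mband mT))//.
transitivity (\int[f a]_(p in dom g `*` carrier Y) (g p.1 S * (\1_T p.2)%:E))%E.
  apply: eq_integral => -[x y] /set_mem gxy; have {gxy}[/= gx Yy] := gxy.
  by rewrite /pktensor_ker /= product_measure1E//= /pkdet_ker /= diracE indicE.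
rewrite [in RHS](_ : _ `&` _ = (dom g `*` carrier Y) `&` (setT `*` T)); last first.
  apply/seteqP; split => -[x y] /=; first by move=> [gx [_ []]].
  by move=> [[gx Yy] [_ Ty]].
rewrite [RHS]integral_mkcondr; apply: eq_integral => -[x y] _; rewrite patchE indicE.
have -> : ((x, y) \in setT `*` T) = (y \in T).
  by apply/idP/idP; rewrite !inE; [move=> []|].
by case: ifPn => _; rewrite ?mule1 ?mule0.
Qed.

End slices.

(** * The empirical sampling morphism *)

Section empirical_kernel.
Variables (R : realType) (X : mspace) (phi : X -> cantor) (psi : cantor -> X).
Hypotheses (mphi : measurable_fun setT phi) (mpsi : measurable_fun setT psi).
Hypothesis phiK : forall x, carrier X x -> psi (phi x) = x.
Hypothesis psiX : forall z, carrier X (psi z).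

Let cell s : set X := phi @^-1` cylinder s.

Let measurable_cell s : measurable (cell s).
Proof. by rewrite -[X in measurable X]setTI; exact: mphi. Qed.

Let weight (u : mpower X) (s : seq bool) : R := upper_frequency R (cell s) u.

Let measurable_weight s : measurable_fun setT (weight ^~ s).
Proof. exact: measurable_upper_frequency. Qed.

(** The condition of [tree_measure] that upper frequencies may violate. *)
Let tree_weights : set (seq bool -> R) :=
  [set w | forall s, w s = w (rcons s false) + w (rcons s true)].

(** The measure is chosen as a function of the weights rather than of the
    sequence; so it is the same for sequences with the same weights. *)
Let weight_tree : exists tm : (seq bool -> R) -> subprobability cantor R,
  forall u, tree_weights (weight u) ->
    tm (weight u) setT = 1%E /\
    forall s, tm (weight u) (cylinder s) = (weight u s)%:E.
Proof.
have /choice[tm tmP] : forall w : seq bool -> R, exists m : subprobability cantor R,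
    (exists2 u, w = weight u & tree_weights w) ->
    m setT = 1%E /\ forall s, m (cylinder s) = (w s)%:E.
  move=> w; have [[u wu tw]|h] := pselect (exists2 u, w = weight u & tree_weights w);
    last by exists mzero.
  have [|||m mE] := @tree_measure R w.
  - by move=> s; rewrite wu; exact: upper_frequency_ge0.
  - by rewrite wu /weight /cell cylinder_nil preimage_setT; exact: upper_frequencyT.
  - exact: tw.
  - by exists m => _; split; [exact: probability_setT|exact: mE].
by exists tm => u tu; apply: tmP; exists u.
Qed.

Let dom_weight : set (mpower X) :=
  [set u | carrier (mpower X) u /\ tree_weights (weight u)].

Let measurable_dom_weight : measurable dom_weight.
Proof.
rewrite (_ : dom_weight = carrier (mpower X) `&` ~` \bigcup_s
  ~` ((weight ^~ s \- (weight ^~ (rcons s false) \+ weight ^~ (rcons s true)))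
       @^-1` [set 0])).
  apply: measurableI; first exact: measurable_carrier.
  apply: measurableC; apply: countable_bigcupT_measurable => // s.
  apply: measurableC; rewrite -[X in measurable X]setTI.
  by apply: measurable_funB => //; exact: measurable_funD.
apply/seteqP; split => u /= [Xu h]; split => //.
  by move=> [s _]; apply; apply/eqP; rewrite /= subr_eq0; apply/eqP; exact: h.
move=> s; apply/eqP; rewrite -subr_eq0; apply: contrapT => ns.
by apply: h; exists s => // e; apply: ns; apply/eqP.
Qed.

Let weight_permute s u : finite_permutation s -> weight (permute_seq s u) = weight u.
Proof. by move=> ps; apply/funext => t; exact: upper_frequency_permute. Qed.

Lemma empirical_measure : exists Lam : pkernel R (mpower X) cantor_space,
  [/\ dom Lam = dom_weight,
      forall u, dom Lam u -> forall s, Lam u (cylinder s) = (weight u s)%:E &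
      forall s u, finite_permutation s -> Lam (permute_seq s u) = Lam u].
Proof.
have [tm tmP] := weight_tree.
have m1 u : dom_weight u -> tm (weight u) setT = 1%E by move=> [_ /tmP[]].
have mtm U : measurable U -> measurable_fun dom_weight (fun u => tm (weight u) U).
  apply: (@measurable_kernel_generated _ _ _ _ _ _ (fun u => tm (weight u)) cylinders).
  - exact: m1.
  - exact: cylindersE.
  - exact: setI_closed_cylinders.
  - move=> _ [->|[s ->]].
      apply: (eq_measurable_fun (cst 0%E)); last exact: measurable_cst.
      by move=> u _; rewrite measure0.
    apply: (eq_measurable_fun (fun u => (weight u s)%:E)).
      by move=> u /set_mem [_ /tmP[_ ->]].
    by apply: measurable_funTS; apply/measurable_EFinP; exact: measurable_weight.
exists (@PKernel R (mpower X) cantor_space (fun u => tm (weight u)) dom_weight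
  (fun u => @proj1 _ _) measurable_dom_weight mtm m1).
split => //; first by move=> u [_ /tmP[]].
by move=> s u ps /=; rewrite weight_permute.
Qed.

Section adequacy.
Variable nu : {measure set (mpower X) -> \bar R}.
Hypothesis nu_fin : (nu setT < +oo)%E.
Hypothesis nu_carrier : nu (~` carrier (mpower X)) = 0%E.
Hypothesis nu_transpose : forall i j (U : set (sequence_space X)), measurable U ->
  nu [set u : sequence_space X | U (u \o transpose i j)] = nu U.

Let frequency_cell s k (u : sequence_space X) : frequency R (cell s) k u =
  frequency R (cell (rcons s false)) k u + frequency R (cell (rcons s true)) k u.
Proof.
rewrite /frequency -mulrDr -big_split/=; congr (_ * _); apply: eq_bigr => i _.
rewrite !indicE -natrD; congr (_%:R).
have cE t : (u i \in cell t) = (phi (u i) \in cylinder t).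
  by apply/idP/idP; rewrite !inE.
rewrite !cE; move: (phi (u i)) => z.
have [zf|zf] := boolP (z \in cylinder (rcons s false)).
  rewrite [z \in cylinder s]mem_set; last by rewrite cylinderU; left; exact/set_mem.
  rewrite memNset// => zt; suff : set0 z by [].
  by rewrite -(cylinderI0 s); split => //; exact/set_mem.
rewrite add0n; congr nat_of_bool; apply/idP/idP; rewrite !inE.
  by rewrite cylinderU => -[/mem_set zf'|//]; rewrite zf' in zf.
by rewrite (cylinderU s) => zt; right.
Qed.

(** Frequencies are additive, and so are their limits wherever they exist. *)
Lemma null_dom_weight : nu (~` dom_weight) = 0%E.
Proof.
apply/negligibleP; first exact: measurableC.
have aew : {ae nu, forall u, tree_weights (weight u)}.
  pose cvg_cell s (u : mpower X) := frequency R (cell s) ^~ u @ \oo --> weight u s.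
  have : {ae nu, forall u, forall n, cvg_cell (odflt [::] (unpickle n)) u}.
    by apply: ae_foralln => n; apply: ae_cvg_frequency.
  apply: filterS => u cu s.
  have cv t : cvg_cell t u by have := cu (pickle t); rewrite pickleK.
  apply: cvg_upper_frequency.
  rewrite (_ : (fun k => _) = (fun k => frequency R (cell (rcons s false)) k u +
     frequency R (cell (rcons s true)) k u)); last first.
    by apply/funext => k; exact: frequency_cell.
  by apply: cvgD; exact: cv.
have aeX : {ae nu, forall u, carrier (mpower X) u}.
  by exists (~` carrier (mpower X)); split => //; exact/measurableC/measurable_carrier.
by apply: filterS2 aeX aew => u.
Qed.

(** De Finetti's theorem for the coded sequence: both sides are finite measures in
    [U], and on boxes of cylinders they are the two sides of
    [expectation_upper_frequency]. *)
Lemma mixture_power (Lam : pkernel R (mpower X) cantor_space)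
    (LamN : pkernel R (mpower X) (mpower cantor_space)) :
  dom Lam = dom_weight ->
  (forall u, dom Lam u -> forall s, Lam u (cylinder s) = (weight u s)%:E) ->
  is_power Lam LamN ->
  forall U : set (sequence_space cantor), measurable U ->
  (\int[nu]_(u in dom LamN) LamN u U)%E = nu [set u : mpower X | U (phi \o u)].
Proof.
move=> domL LE [domN LNE] U mU.
have mphiN : measurable_fun setT (fun u : mpower X => phi \o u : sequence_space cantor).
  apply: measurable_fun_sequence => n.
  exact: (measurableT_comp mphi (@measurable_coordinate _ X n)).
have GT : cylinders setT by right; exists [::]; rewrite cylinder_nil.
have mN : nu (~` dom LamN) = 0%E by rewrite domN domL null_dom_weight.
have M1 : mixture_measure LamN nu setT = nu setT.
  rewrite -[LHS]/(\int[nu]_(u in dom LamN) LamN u setT)%E.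
  rewrite (eq_integral (cst 1%E)) ?integral_cst ?mul1e; last 2 first.
  - exact: measurable_dom.
  - by move=> u /set_mem du; rewrite pk_setT.
  by rewrite -(setTI (dom LamN)) (measure_concentrated (measurable_dom _) mN).
apply: (@measure_unique _ R (sequence_space cantor) (generated_boxes cylinders)
  (fun=> setT) _ _ _ _ (mixture_measure LamN nu) (image_measure nu mphiN)) => //.
- exact: generated_boxesE cylindersE GT.
- exact: setI_closed_generated_boxes setI_closed_cylinders GT.
- by move=> _; exists 0%N, (fun=> setT); split => //; apply/seteqP; split.
- by rewrite bigcup_const//; exists 0%N.
- move=> _ [n [S [GS ->]]].
  have mS i : measurable (S i) by rewrite cylindersE; exact: sub_sigma_algebra.
  rewrite -[LHS]/(\int[nu]_(u in dom LamN) LamN u _)%E.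
  rewrite -[RHS]/(nu [set u : mpower X | forall i, (i < n)%N -> S i (phi (u i))]).
  have LS V u : cylinders V -> dom Lam u ->
      Lam u V = (upper_frequency R (phi @^-1` V) u)%:E.
    move=> [->|[s ->]] du; last exact: LE.
    rewrite measure0 preimage_set0; congr EFin; apply/esym/cvg_upper_frequency.
    rewrite (_ : (fun k => _) = cst 0); first exact: cvg_cst.
    by apply/funext => k; rewrite /frequency big1 ?mulr0// => i _; rewrite indic0.
  have mB i : measurable (phi @^-1` S i).
    by rewrite -[X in measurable X]setTI; exact: mphi.
  apply: etrans (expectation_upper_frequency nu_fin nu_transpose n mB).
  apply/esym.
  rewrite (@ge0_negligible_integral _ _ _ nu setT (~` dom LamN))//; last 3 first.
  - exact/measurableC/measurable_dom.
  - apply/measurable_EFinP; apply: measurable_prod => i _.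
    exact: measurable_upper_frequency.
  - by move=> u _; rewrite lee_fin; apply: prodr_ge0 => i _; exact: upper_frequency_ge0.
  rewrite setTD setCK; apply: eq_integral => u /set_mem; rewrite domN => du; apply/esym.
  rewrite LNE//; elim: (n) => [|k IH]; first by rewrite !big_ord0.
  by rewrite !big_ord_recr/= EFinM IH LS.
- by move=> _; rewrite M1.
Qed.

End adequacy.

(** The kernel is [psi] after the measure of the coded frequencies, and its power
    is the coordinatewise [psi] after the power of that measure.  Adequacy holds
    on each slice because decoding undoes coding on the carrier, and rectangles
    determine the joint law. *)
Lemma retract_empirical_sampling :
  exists es : pkernel R (mpower X) X, empirical_sampling es.
Proof.
have [Lam [domL LE Lperm]] := empirical_measure.
have [LamN LamNP] := power_exists Lam; have [domN LNE] := LamNP.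
have hpsi z : carrier cantor_space z -> carrier X (psi z) by [].
have mpsiN : measurable_fun setT (fun v : mpower cantor_space => psi \o v : mpower X).
  apply: measurable_fun_sequence => n.
  exact: (measurableT_comp mpsi (@measurable_coordinate _ cantor n)).
have hpsiN (v : mpower cantor_space) : carrier (mpower cantor_space) v ->
    carrier (mpower X) (psi \o v : mpower X) by move=> _ n /=.
pose es := pkcomp (@pkdet R cantor_space X psi mpsi hpsi) Lam.
pose esN := pkcomp (@pkdet R (mpower cantor_space) (mpower X) _ mpsiN hpsiN) LamN.
have dom_es : dom es = dom_weight by rewrite dom_pkcomp_pkdet.
have dom_esN : dom esN = dom_weight by rewrite dom_pkcomp_pkdet domN domL.
have esE u U : dom_weight u -> measurable U -> es u U = Lam u (psi @^-1` U).
  by move=> du mU; rewrite pkcomp_pkdetE// domL.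
have esNE u U : dom_weight u -> measurable U ->
    esN u U = LamN u [set v : mpower cantor_space | U (psi \o v)].
  by move=> du mU; rewrite pkcomp_pkdetE// domN domL.
exists es; split=> [s ps|].
  have domp : dom (pkcomp es (pkperm R X s)) = dom_weight.
    apply/seteqP; split => u.
      move=> [Xu]; rewrite -[X in X = _]/(\d_(permute_seq s u) (dom es)) diracE dom_es.
      have [/set_mem [_ tw] _|_] := boolP (permute_seq s u \in dom_weight).
        by split => //; rewrite weight_permute in tw.
      by move=> /eqP; rewrite eqe eq_sym oner_eq0.
    move=> [Xu tw]; split => //.
    rewrite -[LHS]/(\d_(permute_seq s u) (dom es)) diracE dom_es mem_set//.
    by split; [exact: permute_seq_carrier|rewrite weight_permute].
  split=> [|u]; first by rewrite domp dom_es.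
  rewrite domp => du U mU; have [Xu tw] := du.
  have dpu : dom_weight (permute_seq s u).
    by split; [exact: permute_seq_carrier|rewrite weight_permute].
  rewrite -[LHS]/(\int[\d_(permute_seq s u)]_(v in dom es) es v U)%E.
  rewrite (@integral_dirac _ _ (permute_seq s u) _ _ (measurable_dom es) _
    (measurable_pk es mU)).
  by rewrite diracE dom_es mem_set// mul1e !esE// Lperm.
exists esN.
  split=> [|u]; first by rewrite dom_esN dom_es.
  rewrite dom_es => du n S mS; rewrite esNE//; last first.
    by rewrite boxesE; apply: sub_sigma_algebra; exists n, S.
  have mpS i : measurable (psi @^-1` S i).
    by rewrite -[X in measurable X]setTI; exact: mpsi.
  apply: etrans (LNE u _ n (fun i => psi @^-1` S i) mpS) _; first by rewrite domL.
  by apply: eq_bigr => i _; rewrite esE.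
move=> A Y _ _ f exf.
(* A slice inherits exchangeability, so de Finetti's theorem applies to it. *)
have sliced a (fa : dom f a) T (mT : measurable T) :
    slice f a mT (~` dom_weight) = 0%E /\
    forall S, measurable S ->
      (\int[slice f a mT]_(u in dom esN) esN u S)%E = slice f a mT S.
  pose nu := slice f a mT.
  have nu_fin : (nu setT < +oo)%E by exact: slice_lty.
  have nuX : nu (~` carrier (mpower X)) = 0%E by exact: slice_carrierC.
  have mX := measurable_carrier (mpower X).
  have nuT i j (U : set (sequence_space X)) : measurable U ->
      nu [set u : sequence_space X | U (u \o transpose i j)] = nu U.
    move=> mU; have [dE kE] := exf _ (finite_permutation_transpose i j).
    have mUT : measurable (U `*` T : set (mprod (mpower X) Y)) by exact: measurableX.
    have mpU : measurable [set u : mpower X | U (u \o transpose i j)].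
      rewrite -[X in measurable X]setTI.
      exact: (@measurable_permute_seq X (transpose i j) measurableT U mU).
    rewrite [RHS]slice_rect// -(kE a _ _ mUT) ?dE// pkcomp_tensor_rect//.
    rewrite -[LHS](measure_concentrated mX nuX mpU).
    rewrite -[RHS]/(\int[nu]_(u in carrier (mpower X))
      \d_(permute_seq (transpose i j) u) U)%E.
    by rewrite -integral_indic//; apply: eq_integral => u _; rewrite diracE indicE.
  have nuD : nu (~` dom_weight) = 0%E by exact: null_dom_weight.
  split => // S mS.
  have mpS : measurable [set v : mpower cantor_space | S (psi \o v)].
    by rewrite -[X in measurable X]setTI; exact: (mpsiN measurableT S mS).
  have mppS : measurable [set u : mpower X | S (psi \o (phi \o u))].
    have mphiN : measurable_fun setT (fun u : mpower X => phi \o u : mpower cantor_space).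
      apply: measurable_fun_sequence => n.
      exact: (measurableT_comp mphi (@measurable_coordinate _ X n)).
    by rewrite -[X in measurable X]setTI; exact: (mphiN measurableT _ mpS).
  transitivity (\int[nu]_(u in dom LamN)
      LamN u [set v : mpower cantor_space | S (psi \o v)])%E.
    rewrite domN domL dom_esN; apply: eq_integral => u /set_mem du.
    exact: esNE.
  rewrite (mixture_power nu_fin nuX nuT domL LE LamNP mpS).
  rewrite -[LHS](measure_concentrated mX nuX mppS) -[RHS](measure_concentrated mX nuX mS).
  congr (nu _); apply/seteqP; split => u /= [Su Xu]; split => //.
    rewrite (_ : u = psi \o (phi \o u))//; apply/funext => n /=.
    by rewrite phiK//; exact: Xu.
  rewrite (_ : psi \o (phi \o u) = u)//; apply/funext => n /=.
  by rewrite phiK//; exact: Xu.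
have domf : dom (pkcomp (pktensor esN (pkid R Y)) f) = dom f.
  apply/seteqP; split => a; first by case.
  move=> fa; split=> //; have [nuD _] := sliced a fa setT measurableT.
  transitivity (slice f a (@measurableT _ Y) (dom esN)).
    rewrite sliceE; congr (f a _); apply/seteqP; split => -[u y] /=.
      by move=> [du Yy]; split.
    by move=> [du [_ Yy]]; split.
  have mD : measurable (dom esN) by exact: measurable_dom.
  rewrite -(setTI (dom esN)) (measure_concentrated mD)// ?dom_esN//.
  rewrite slice_rect// setXTT; exact: pk_setT.
split => // a; rewrite domf => fa U mU.
apply: (@measure_unique _ R (mprod (mpower X) Y)
  [set S `*` T | S in measurable & T in measurable] (fun=> setT) _ _ _ _
  (pkcomp (pktensor esN (pkid R Y)) f a) (f a)) => //.
- exact: measurable_prod_measurableType.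
- move=> _ _ [S mS [T mT <-]] [S' mS' [T' mT' <-]].
  exists (S `&` S'); first exact: measurableI.
  by exists (T `&` T'); [exact: measurableI|rewrite setXI].
- by move=> _; exists setT => //; exists setT => //; rewrite setXTT.
- by rewrite bigcup_const//; exists 0%N.
- move=> _ [S mS [T mT <-]].
  apply: etrans (pkcomp_tensor_rect f a mT esN mS) _.
  by rewrite (sliced a fa T mT).2//; exact: slice_rect.
- move=> _; apply: le_lt_trans (sprobability_setT (s := pkcomp _ f a)) _.
  exact: ltry.
Qed.

End empirical_kernel.

(** If [X] is empty there is no point to decode to, but then all kernels concerned
    have empty domain: a probability measure on an empty carrier is absurd. *)
Lemma empty_empirical_sampling (R : realType) (X : mspace) :
  carrier X = set0 -> exists es : pkernel R (mpower X) X, empirical_sampling es.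
Proof.
move=> X0; have XN0 : carrier (mpower X) = set0.
  by apply/seteqP; split => // u /(_ 0%N); rewrite X0.
have empty_kernel (Z : mspace) : exists g : pkernel R (mpower X) Z, dom g = set0.
  have m0 U : measurable U ->
      measurable_fun set0 (fun _ : mpower X => @mzero _ Z R U).
    by move=> _; exact: measurable_fun_set0.
  have c1 (x : mpower X) : set0 x -> @mzero _ Z R (carrier Z) = 1%E by [].
  by exists (@PKernel R (mpower X) Z (fun=> mzero) set0 (@sub0set _ _)
    measurable0 m0 c1).
have [es des] := empty_kernel X; have [esN desN] := empty_kernel (mpower X).
exists es; split=> [s _|].
  have d0 : dom (pkcomp es (pkperm R X s)) = set0.
    by apply/seteqP; split => // u [/dom_carrier]; rewrite XN0.
  by split=> [|u]; rewrite d0 ?des.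
exists esN; first by split=> [|u]; rewrite ?desN des.
move=> A Y _ _ f _.
have f0 : dom f = set0.
  apply/seteqP; split => // a /(pk_carrier f).
  rewrite (_ : carrier _ = set0) ?measure0; last first.
    by rewrite /= [X in X `*` _]XN0 set0X.
  by move=> /eqP; rewrite eqe eq_sym oner_eq0.
have d0 : dom (pkcomp (pktensor esN (pkid R Y)) f) = set0.
  by apply/seteqP; split => // a [+ _]; rewrite f0.
by split=> [|a]; rewrite d0 ?f0.
Qed.

Theorem corollary3p13 (R : realType) (X : mspace) (hX : standard_borel R X) :
  exists es : pkernel R (mpower X) X, empirical_sampling es.
Proof.
have [/eqP X0|/set0P X0] := boolP (carrier X == set0).
  exact: empty_empirical_sampling.
have [phi [psi [mphi mpsi phiK psiX]]] := standard_borel_retract hX X0.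
exact: retract_empirical_sampling mphi mpsi phiK psiX.
Qed.
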